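(* The assignment on generators $$E_{i,j}\mapsto 1^*,\qquad \Omega_{i,j}\mapsto b_{i,j}^*,\qquad L_{i,j}\mapsto a_{i,j}^*$$ (with values in $\mathsf{R}^*(\{i,j\})$) defines a map $\rho$ of Hopf operads from $\mathrm{Ram}$ to $\mathsf{R}^*$. The map $\rho$ intertwines $d$ with $D^*$ and $d'$ with $(D')^*$; that is, writing $\rho^*$ for the transpose of $\rho$, one has $\rho^*\circ d=D^*\circ\rho^*$ and $\rho^*\circ d'=(D')^*\circ\rho^*$ (equivalently $\rho\circ D=d^*\circ\rho$ and $\rho\circ D'=(d')^*\circ\rho$).
   Context: The ground field is $\mathbb{C}$. Everything is $(\mathbb{Z},\mathbb{Z})$-bigraded, and Koszul signs are taken with respect to the first degree only. ''Symmetric'' means $X_{i,j}=X_{j,i}$; ''antisymmetric'' means $X_{i,j}=-X_{j,i}$. The sign $\sum_{cycl}$ denotes the sum over the three cyclic permutations of $i,j,k$. Operads. An operad $\mathcal{P}$ is a functor from finite sets and bijections to bigraded vector spaces with composition maps $\circ_\star:\mathcal{P}(I\sqcup\{\star\})\otimes\mathcal{P}(J)\to\mathcal{P}(I\sqcup J)$ satisfying the usual axioms (partial compositions). A Hopf operad is an operad in which each $\mathcal{P}(I)$ is a coalgebra and the composition maps are morphisms of coalgebras; a map of Hopf operads is a morphism of operads which is a morphism of coalgebras on each $\mathcal{P}(I)$. The Hopf operad $\mathrm{Ram}$. It is generated by $E_{i,j}$ symmetric of degree $(0,0)$, $L_{i,j}$ antisymmetric of degree $(0,1)$, $\Omega_{i,j}$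 antisymmetric of degree $(1,1)$, modulo $$E_{i,\star}\circ_\star E_{j,k}=E_{j,\star}\circ_\star E_{k,i},\qquad \sum_{cycl}L_{i,\star}\circ_\star L_{j,k}=0,$$ $$\sum_{cycl}\left(\Omega_{i,\star}\circ_\star L_{j,k}+L_{i,\star}\circ_\star\Omega_{j,k}\right)=0,$$ $$L_{i,\star}\circ_\star E_{j,k}=E_{j,\star}\circ_\star L_{i,k}+E_{k,\star}\circ_\star L_{i,j},\qquad \Omega_{i,\star}\circ_\star E_{j,k}=E_{j,\star}\circ_\star\Omega_{i,k}+E_{k,\star}\circ_\star\Omega_{i,j}.$$ Its coproduct is compatible with composition and given by $\Delta(E_{i,j})=E_{i,j}\otimes E_{i,j}$, $\Delta(L_{i,j})=E_{i,j}\otimes L_{i,j}+L_{i,j}\otimes E_{i,j}$, $\Delta(\Omega_{i,j})=E_{i,j}\otimes\Omega_{i,j}+\Omega_{i,j}\otimes E_{i,j}$. It has two differentials $D$, $D'$, which are derivations for composition ($\delta(x\circ_\star y)=\delta(x)\circ_\star y+(-1)^{|x|}x\circ_\star\delta(y)$, $|x|$ the first degree), given by $D(E_{i,j})=0$, $D(\Omega_{i,j})=L_{i,j}$, $D(L_{i,j})=0$; $D'(E_{i,j})=0$, $D'(L_{i,j})=\Omega_{i,j}$, $D'(\Omega_{i,j})=0$. The cooperad $\mathsf{R}$. For a finite set $I$, $\mathsf{R}(I)$ is the unital (graded-)commutative associative algebra generated by $a_{i,j}$ antisymmetric of degree $(0,1)$ and $b_{i,j}$ antisymmetric of degree $(1,1)$,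 for distinct $i,j\in I$, modulo (all displayed indices pairwise distinct) $$a_{i,j}^2=0,\qquad a_{i,j}a_{j,k}+a_{j,k}a_{k,i}+a_{k,i}a_{i,j}=0,$$ $$b_{i,j}a_{j,k}+b_{j,k}a_{k,i}+b_{k,i}a_{i,j}+a_{i,j}b_{j,k}+a_{j,k}b_{k,i}+a_{k,i}b_{i,j}=0,$$ $$a_{i_0,i_1}b_{i_1,i_2}b_{i_2,i_3}\cdots b_{i_n,i_0}=0\ (n\ge1),\qquad b_{i_0,i_1}b_{i_1,i_2}b_{i_2,i_3}\cdots b_{i_n,i_0}=0\ (n\ge1),$$ $$\sum_{w}b_{w_1,w_2}a_{w_2,w_3}b_{w_3,w_4}=0,\qquad \sum_{w}b_{w_1,w_2}b_{w_2,w_3}b_{w_3,w_4}=0,$$ where $w=(w_1,w_2,w_3,w_4)$ runs over the 12 words $ijk\ell$, $ikj\ell$, $ij\ell k$, $i\ell jk$, $ik\ell j$, $i\ell kj$, $jik\ell$, $jki\ell$, $ji\ell k$, $j\ell ik$, $kij\ell$, $kji\ell$. The algebras $\mathsf{R}(I)$ are finite-dimensional. They carry the derivations $d$ (degree $(1,0)$), $d'$ (degree $(-1,0)$) with $d(a_{i,j})=b_{i,j}$, $d(b_{i,j})=0$, $d'(b_{i,j})=a_{i,j}$, $d'(a_{i,j})=0$. The cocomposition $\Theta^{\star}_{I,J}:\mathsf{R}(I\sqcup J)\to\mathsf{R}(I\sqcup\{\star\})\otimes\mathsf{R}(J)$ is the algebra morphism with, for $c\in\{a,b\}$: $c_{i,j}\mapsto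 c_{i,j}\otimes1$ if $i,j\in I$; $1\otimes c_{i,j}$ if $i,j\in J$; $c_{i,\star}\otimes1$ if $i\in I$, $j\in J$. This makes $\mathsf{R}$ a cooperad in algebras. The dual $\mathsf{R}^*$. $\mathsf{R}^*(I)$ is the dual vector space of $\mathsf{R}(I)$, bigraded so that the dual of the component of degree $(p,q)$ has degree $(p,q)$. It is a Hopf operad: composition is the transpose of $\Theta$, i.e. $(f\circ_\star g)(x)=(f\otimes g)(\Theta^{\star}_{I,J}(x))$, and the coproduct is the transpose of the product of $\mathsf{R}(I)$, using the pairing $(f\otimes g)(x\otimes y)=f(x)g(y)$. The maps $d^*$, $(d')^*$, $D^*$, $(D')^*$ are the transposes. The elements $1^*$, $a_{i,j}^*$, $b_{i,j}^*$ of $\mathsf{R}^*(I)$ are the dual basis elements to $1$, $a_{i,j}$, $b_{i,j}$ in the components of degree $(0,0)$, $(0,1)$, $(1,1)$ respectively (with $a^*_{j,i}=-a^*_{i,j}$ and $b^*_{j,i}=-b^*_{i,j}$). *)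

(* Defs.v *)
From HB Require Import structures.
From mathcomp Require Import all_boot all_order all_algebra.
From mathcomp Require Import boolp classical_sets functions cardinality reals.
From mathcomp.real_closed Require Import complex.
Set Implicit Arguments.
Unset Strict Implicit.
Unset Printing Implicit Defensive.
Import Order.TTheory GRing.Theory Num.Theory.
Local Open Scope ring_scope.
Local Open Scope quotient_scope.

(** Every object given by generators and relations below (tensor products, the
    algebras R(I), the spaces Ram(I)) is the quotient of a type of formal
    expressions by the least congruence satisfying the required identities. *)

(** * Quotients of formal expressions by a congruence *)

Record lmod_congr (K : fieldType) (T : Type) (zero : T) (add : T -> T -> T)
    (scale : K -> T -> T) (E : T -> T -> Prop) : Prop := LmodCongr {
  lc_refl : forall x, E x x;
  lc_sym : forall x y, E x y -> E y x;
  lc_trans : forall x y z, E x y -> E y z -> E x z;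
  lc_add : forall x x' y y', E x x' -> E y y' -> E (add x y) (add x' y');
  lc_scale : forall k x x', E x x' -> E (scale k x) (scale k x');
  lc_addA : forall x y z, E (add x (add y z)) (add (add x y) z);
  lc_addC : forall x y, E (add x y) (add y x);
  lc_add0 : forall x, E (add zero x) x;
  lc_addN : forall x, E (add (scale (-1) x) x) zero;
  lc_scaleA : forall k l x, E (scale k (scale l x)) (scale (k * l) x);
  lc_scale1 : forall x, E (scale 1 x) x;
  lc_scaleDr : forall k x y, E (scale k (add x y)) (add (scale k x) (scale k y));
  lc_scaleDl : forall k l x, E (scale (k + l) x) (add (scale k x) (scale l x)) }.

Lemma meet_lmod_congr (K : fieldType) (T A : Type) (zero : T) (add : T -> T -> T)
    (scale : K -> T -> T) (P : A -> Prop) (E : A -> T -> T -> Prop) :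
  (forall a, P a -> lmod_congr zero add scale (E a)) ->
  lmod_congr zero add scale (fun x y => forall a, P a -> E a x y).
Proof.
move=> H; split.
- by move=> x a /H hE; apply: (lc_refl hE).
- by move=> x y h a ha; apply: (lc_sym (H a ha)); apply: h.
- by move=> x y z h1 h2 a ha; apply: (lc_trans (H a ha) (h1 a ha)); apply: h2.
- by move=> x x' y y' h1 h2 a ha; apply: (lc_add (H a ha)); [apply: h1|apply: h2].
- by move=> k x x' h a ha; apply: (lc_scale (H a ha)); apply: h.
- by move=> x y z a /H hE; apply: (lc_addA hE).
- by move=> x y a /H hE; apply: (lc_addC hE).
- by move=> x a /H hE; apply: (lc_add0 hE).
- by move=> x a /H hE; apply: (lc_addN hE).
- by move=> k l x a /H hE; apply: (lc_scaleA hE).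
- by move=> x a /H hE; apply: (lc_scale1 hE).
- by move=> k x y a /H hE; apply: (lc_scaleDr hE).
- by move=> k l x a /H hE; apply: (lc_scaleDl hE).
Qed.

Record lmod_presentation (K : fieldType) := LmodPresentation {
  lp_term : Type;
  lp_zero : lp_term;
  lp_add : lp_term -> lp_term -> lp_term;
  lp_scale : K -> lp_term -> lp_term;
  lp_eqv : lp_term -> lp_term -> Prop;
  lp_congr : lmod_congr lp_zero lp_add lp_scale lp_eqv }.

Section LmodQuotient.
Context {K : fieldType} (M : lmod_presentation K).
Notation T := {classic (lp_term M)}.

Definition lp_rel : rel T := fun x y => `[< lp_eqv (x : lp_term M) y >].

Lemma lp_rel_equiv : equiv_class_of lp_rel.
Proof.
split=> [x|x y|y x z].
- exact/asboolP/(lc_refl (lp_congr M)).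
- by apply/asboolP/asboolP => h; apply: (lc_sym (lp_congr M)).
- by move=> /asboolP h1 /asboolP h2; apply/asboolP/(lc_trans (lp_congr M) h1 h2).
Qed.

Canonical lp_equiv_rel := EquivRelPack lp_rel_equiv.

Definition lmod_quot := {eq_quot lp_equiv_rel}.

Definition cls (t : lp_term M) : lmod_quot := \pi_lmod_quot (t : T).
Definition rep (x : lmod_quot) : lp_term M := (repr x : T).

Lemma repK x : cls (rep x) = x.
Proof. exact: reprK. Qed.

Lemma clsP t u : cls t = cls u <-> lp_eqv t u.
Proof.
split=> [/eqmodP/asboolP//|h].
by apply/eqmodP/asboolP.
Qed.

Lemma rep_cls t : lp_eqv (rep (cls t)) t.
Proof. by apply/clsP; rewrite repK. Qed.

HB.instance Definition _ := Choice.on lmod_quot.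

Let qadd (x y : lmod_quot) := cls (lp_add (rep x) (rep y)).
Let qscale k (x : lmod_quot) := cls (lp_scale k (rep x)).

Let qaddE t u : qadd (cls t) (cls u) = cls (lp_add t u).
Proof. by apply/clsP/(lc_add (lp_congr M)); exact: rep_cls. Qed.

Let qscaleE k t : qscale k (cls t) = cls (lp_scale k t).
Proof. by apply/clsP/(lc_scale (lp_congr M)); exact: rep_cls. Qed.

Let qaddA : associative qadd.
Proof.
move=> x y z; rewrite -[x]repK -[y]repK -[z]repK !qaddE.
exact/clsP/(lc_addA (lp_congr M)).
Qed.

Let qaddC : commutative qadd.
Proof.
by move=> x y; rewrite -[x]repK -[y]repK !qaddE; apply/clsP/(lc_addC (lp_congr M)).
Qed.

Let qadd0 : left_id (cls (lp_zero M)) qadd.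
Proof. by move=> x; rewrite -[x]repK qaddE; apply/clsP/(lc_add0 (lp_congr M)). Qed.

Let qaddN : left_inverse (cls (lp_zero M)) (qscale (-1)) qadd.
Proof.
by move=> x; rewrite -[x]repK qscaleE qaddE; apply/clsP/(lc_addN (lp_congr M)).
Qed.

HB.instance Definition _ :=
  GRing.isZmodule.Build lmod_quot qaddA qaddC qadd0 qaddN.

Let qscaleA k l x : qscale k (qscale l x) = qscale (k * l) x.
Proof.
by rewrite -[x]repK !qscaleE; apply/clsP/(lc_scaleA (lp_congr M)).
Qed.

Let qscale1 : left_id 1 qscale.
Proof. by move=> x; rewrite -[x]repK qscaleE; apply/clsP/(lc_scale1 (lp_congr M)). Qed.

Let qscaleDr : right_distributive qscale qadd.
Proof.
move=> k x y; rewrite -[x]repK -[y]repK !(qscaleE, qaddE).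
exact/clsP/(lc_scaleDr (lp_congr M)).
Qed.

Let qscaleDl x k l : qscale (k + l) x = qadd (qscale k x) (qscale l x).
Proof.
rewrite -[x]repK !(qscaleE, qaddE).
exact/clsP/(lc_scaleDl (lp_congr M)).
Qed.

HB.instance Definition _ := GRing.Zmodule_isLmodule.Build K lmod_quot
  qscaleA qscale1 qscaleDr qscaleDl.

Lemma clsD t u : cls (lp_add t u) = cls t + cls u.
Proof. exact/esym/qaddE. Qed.

Lemma clsZ k t : cls (lp_scale k t) = k *: cls t.
Proof. exact/esym/qscaleE. Qed.

End LmodQuotient.

(** * Tensor products over K *)

Inductive tens_term (K U V : Type) : Type :=
| TZero
| TAdd of tens_term K U V & tens_term K U V
| TScale of K & tens_term K U V
| TPure of U & V.
Arguments TZero {K U V}.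
Arguments TPure {K U V}.

Section Tensor.
Context {K : fieldType}.

Record tens_congr (U V : lmodType K) (E : tens_term K U V -> tens_term K U V -> Prop)
    : Prop := TensCongr {
  tc_lmod :> lmod_congr TZero (@TAdd K U V) (@TScale K U V) E;
  tc_addl : forall u u' v, E (TPure (u + u') v) (TAdd (TPure u v) (TPure u' v));
  tc_addr : forall u v v', E (TPure u (v + v')) (TAdd (TPure u v) (TPure u v'));
  tc_scalel : forall k u v, E (TPure (k *: u) v) (TScale k (TPure u v));
  tc_scaler : forall k u v, E (TPure u (k *: v)) (TScale k (TPure u v)) }.

Definition tens_eqv (U V : lmodType K) (s t : tens_term K U V) : Prop :=
  forall E, tens_congr E -> E s t.

Lemma tens_eqv_lmod (U V : lmodType K) :
  lmod_congr TZero (@TAdd K U V) (@TScale K U V) (@tens_eqv U V).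
Proof.
by apply: (meet_lmod_congr (E := id)) => E /tc_lmod.
Qed.

Definition tens_pres (U V : lmodType K) := LmodPresentation (@tens_eqv_lmod U V).

Definition tensor (U V : lmodType K) : lmodType K := lmod_quot (tens_pres U V).

Definition tens (U V : lmodType K) (u : U) (v : V) : tensor U V :=
  cls (M := tens_pres U V) (TPure u v).

Fixpoint tens_fold (U V W : lmodType K) (B : U -> V -> W) (t : tens_term K U V) : W :=
  match t with
  | TZero => 0
  | TAdd s t => tens_fold B s + tens_fold B t
  | TScale k s => k *: tens_fold B s
  | TPure u v => B u v
  end.

(** The linear map induced by a bilinear map [B]. *)
Definition tens_lift (U V W : lmodType K) (B : U -> V -> W) (t : tensor U V) : W :=
  tens_fold B (rep t).

Definition tens_form (U V : lmodType K) (f : U -> K^o) (g : V -> K^o)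
    (t : tensor U V) : K := tens_lift (fun u v => (f u * g v : K^o)) t.

End Tensor.

(** * Finite sets, bijections and bigradings *)

(** Finite sets with carrier in [Set] rather than [finType]s: the formal composites of an
    operad quantify over all finite sets, and quantifying over [finType]s would put them
    in a universe too large for an [lmodType]. *)
Record FiniteSet := MkFiniteSet { fs_car : Set; fs_finite : finite_set [set: fs_car] }.
#[reversible] Coercion fs_car : FiniteSet >-> Sortclass.

HB.instance Definition _ (I : FiniteSet) := gen_eqMixin (fs_car I).

Lemma option_finite (I : FiniteSet) : finite_set [set: option I].
Proof.
have -> : ([set: option I] = [set None] `|` Some @` [set: I])%classic.
  by apply/seteqP; split=> // -[i _|_]; [right; exists i|left].
by rewrite finite_setU; split=> //; apply/finite_image/fs_finite.
Qed.

Lemma sum_finite (I J : FiniteSet) : finite_set [set: I + J].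
Proof.
have -> : ([set: I + J] = inl @` [set: I] `|` inr @` [set: J])%classic.
  by apply/seteqP; split=> // -[i _|j _]; [left; exists i|right; exists j].
by rewrite finite_setU; split; apply/finite_image/fs_finite.
Qed.

Canonical fs_void := MkFiniteSet (finite_finset : finite_set [set: void]).
Canonical fs_unit := MkFiniteSet (finite_finset : finite_set [set: unit]).
Canonical fs_bool := MkFiniteSet (finite_finset : finite_set [set: bool]).
Canonical fs_option (I : FiniteSet) := MkFiniteSet (option_finite I).
Canonical fs_sum (I J : FiniteSet) := MkFiniteSet (sum_finite I J).

Definition bideg : Type := (int * int)%type.

Definition koszul (K : fieldType) (p q : bideg) : K := (-1) ^ (p.1 * q.1).

Record bij (I J : FiniteSet) := Bij {
  bij_fun :> I -> J;
  bij_inv : J -> I;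
  bij_funK : cancel bij_fun bij_inv;
  bij_invK : cancel bij_inv bij_fun }.

Definition bij_symm (I J : FiniteSet) (s : bij I J) : bij J I :=
  Bij (bij_invK s) (bij_funK s).

Definition bij_id (I : FiniteSet) : bij I I :=
  @Bij I I id id (fun=> erefl) (fun=> erefl).

(** * The algebras R(I) *)

Inductive ab := ga | gb.

Definition ab_deg (c : ab) : bideg := if c is ga then (0, 1) else (1, 1).

Inductive R_term (K : Type) (I : FiniteSet) : Type :=
| RZero
| RAdd of R_term K I & R_term K I
| RScale of K & R_term K I
| ROne
| RMul of R_term K I & R_term K I
| RGen of ab & I & I.
Arguments RZero {K I}.
Arguments ROne {K I}.
Arguments RGen {K I}.

Inductive R_hdeg (K : Type) (I : FiniteSet) : bideg -> R_term K I -> Prop :=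
| RhZero p : R_hdeg p RZero
| RhAdd p s t : R_hdeg p s -> R_hdeg p t -> R_hdeg p (RAdd s t)
| RhScale p k t : R_hdeg p t -> R_hdeg p (RScale k t)
| RhOne : R_hdeg (0, 0) ROne
| RhMul p q s t : R_hdeg p s -> R_hdeg q t -> R_hdeg (p + q) (RMul s t)
| RhGen c i j : R_hdeg (ab_deg c) (RGen c i j).

Section Ralgebra.
Context {K : fieldType}.

Section Relations.
Context (I : FiniteSet).
Notation T := (R_term K I).
Notation a := (@RGen K I ga).
Notation b := (@RGen K I gb).
Notation "s ** t" := (RMul s t) (at level 40, left associativity).

Definition R_sum (s : seq T) : T := foldr (@RAdd K I) RZero s.

(** [b_chain i1 [:: i2; ..; in]] is [b_{i1,i2} b_{i2,i3} .. b_{i(n-1),in}]. *)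
Fixpoint b_chain (i : I) (s : seq I) : T :=
  if s is j :: s' then b i j ** b_chain j s' else ROne.

Definition words4 (i j k l : I) : seq (I * I * I * I) :=
  [:: (i, j, k, l); (i, k, j, l); (i, j, l, k); (i, l, j, k); (i, k, l, j); (i, l, k, j);
      (j, i, k, l); (j, k, i, l); (j, i, l, k); (j, l, i, k); (k, i, j, l); (k, j, i, l)].

(** [RGen c i i] is a spurious symbol, set to zero by [rc_diag]: the algebra is
    generated by the [RGen c i j] with [i != j]. *)
Record R_congr (E : T -> T -> Prop) : Prop := RCongr {
  rc_lmod :> lmod_congr RZero (@RAdd K I) (@RScale K I) E;
  rc_mul : forall s s' t t', E s s' -> E t t' -> E (s ** t) (s' ** t');
  rc_mulA : forall s t u, E (s ** (t ** u)) (s ** t ** u);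
  rc_mul1l : forall s, E (ROne ** s) s;
  rc_mul1r : forall s, E (s ** ROne) s;
  rc_mulDl : forall s t u, E (RAdd s t ** u) (RAdd (s ** u) (t ** u));
  rc_mulDr : forall s t u, E (s ** RAdd t u) (RAdd (s ** t) (s ** u));
  rc_mulZl : forall k s t, E (RScale k s ** t) (RScale k (s ** t));
  rc_mulZr : forall k s t, E (s ** RScale k t) (RScale k (s ** t));
  rc_comm : forall p q s t, R_hdeg p s -> R_hdeg q t ->
    E (s ** t) (RScale (koszul K p q) (t ** s));
  rc_diag : forall c i, E (RGen c i i) RZero;
  rc_anti : forall c i j, i != j -> E (RGen c j i) (RScale (-1) (RGen c i j));
  rc_aa : forall i j, i != j -> E (a i j ** a i j) RZero;
  rc_arnold : forall i j k, uniq [:: i; j; k] ->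
    E (R_sum [:: a i j ** a j k; a j k ** a k i; a k i ** a i j]) RZero;
  rc_mixed : forall i j k, uniq [:: i; j; k] ->
    E (R_sum [:: b i j ** a j k; b j k ** a k i; b k i ** a i j;
                 a i j ** b j k; a j k ** b k i; a k i ** b i j]) RZero;
  rc_cycle_ab : forall i0 i1 s, uniq [:: i0, i1 & s] ->
    E (a i0 i1 ** b_chain i1 (rcons s i0)) RZero;
  rc_cycle_bb : forall i0 i1 s, uniq [:: i0, i1 & s] ->
    E (b i0 i1 ** b_chain i1 (rcons s i0)) RZero;
  rc_bab : forall i j k l, uniq [:: i; j; k; l] ->
    E (R_sum [seq let: (w1, w2, w3, w4) := w in b w1 w2 ** a w2 w3 ** b w3 w4
             | w <- words4 i j k l]) RZero;
  rc_bbb : forall i j k l, uniq [:: i; j; k; l] ->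
    E (R_sum [seq let: (w1, w2, w3, w4) := w in b w1 w2 ** b w2 w3 ** b w3 w4
             | w <- words4 i j k l]) RZero }.

Definition R_eqv (s t : T) : Prop := forall E, R_congr E -> E s t.

Lemma R_eqv_lmod : lmod_congr RZero (@RAdd K I) (@RScale K I) R_eqv.
Proof. by apply: (meet_lmod_congr (E := id)) => E /rc_lmod. Qed.

End Relations.

Definition R_pres (I : FiniteSet) := LmodPresentation (R_eqv_lmod I).

Definition Ralg (I : FiniteSet) := lmod_quot (R_pres I).

HB.instance Definition _ I := GRing.Lmodule.on (Ralg I).

Definition R_cls I (t : R_term K I) : Ralg I := cls (M := R_pres I) t.

Lemma R_clsD I (s t : R_term K I) : R_cls (RAdd s t) = R_cls s + R_cls t.
Proof. exact: (clsD (M := R_pres I)). Qed.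

Lemma R_clsZ I k (t : R_term K I) : R_cls (RScale k t) = k *: R_cls t.
Proof. exact: (clsZ (M := R_pres I)). Qed.

Section Ring.
Context (I : FiniteSet).

Let rmul (x y : Ralg I) : Ralg I := R_cls (RMul (rep x) (rep y)).

Let rmulE s t : rmul (R_cls s) (R_cls t) = R_cls (RMul s t).
Proof.
apply/clsP => E hE; apply: (rc_mul hE).
  exact: (rep_cls (M := R_pres I) s E hE).
exact: (rep_cls (M := R_pres I) t E hE).
Qed.

Let R_clsP x : exists t, x = R_cls t :> Ralg I.
Proof. by exists (rep x); rewrite /R_cls repK. Qed.

Let rmulA : associative rmul.
Proof.
move=> x y z; have [[s ->] [[t ->] [u ->]]] := (conj (R_clsP x) (conj (R_clsP y) (R_clsP z))).
by rewrite !rmulE; apply/clsP => E hE; apply: (rc_mulA hE).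
Qed.

Let rmul1l : left_id (R_cls ROne) rmul.
Proof.
move=> x; have [s ->] := R_clsP x.
by rewrite !rmulE; apply/clsP => E hE; apply: (rc_mul1l hE).
Qed.

Let rmul1r : right_id (R_cls ROne) rmul.
Proof.
move=> x; have [s ->] := R_clsP x.
by rewrite !rmulE; apply/clsP => E hE; apply: (rc_mul1r hE).
Qed.

Let rmulDl : left_distributive rmul +%R.
Proof.
move=> x y z; have [[s ->] [[t ->] [u ->]]] := (conj (R_clsP x) (conj (R_clsP y) (R_clsP z))).
by rewrite -R_clsD !rmulE -R_clsD; apply/clsP => E hE; apply: (rc_mulDl hE).
Qed.

Let rmulDr : right_distributive rmul +%R.
Proof.
move=> x y z; have [[s ->] [[t ->] [u ->]]] := (conj (R_clsP x) (conj (R_clsP y) (R_clsP z))).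
by rewrite -R_clsD !rmulE -R_clsD; apply/clsP => E hE; apply: (rc_mulDr hE).
Qed.

HB.instance Definition _ := GRing.Zmodule_isPzRing.Build (Ralg I)
  rmulA rmul1l rmul1r rmulDl rmulDr.

Lemma R_clsM s t : R_cls (RMul s t) = R_cls s * R_cls t.
Proof. exact/esym/rmulE. Qed.

End Ring.

Definition R_gen (I : FiniteSet) (c : ab) (i j : I) : Ralg I := R_cls (RGen c i j).

Definition R_homog (I : FiniteSet) (p : bideg) (x : Ralg I) : Prop :=
  exists2 t, R_hdeg p t & x = R_cls t.

End Ralgebra.
Arguments Ralg K I : clear implicits.

(** * Structure maps of R *)

(** The structure maps of R and Ram are first written on formal expressions. They send
    congruent expressions to equal elements of the target, so that on the quotients they
    can be computed on any representative, in particular on [rep x]. *)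

Section Rstructure.
Context {K : fieldType}.
Notation R := (Ralg K).

(** The parity involution, [x] to [(-1)^{|x|} x]. *)
Fixpoint R_sgn_term (I : FiniteSet) (t : R_term K I) : R_term K I :=
  match t with
  | RZero => RZero
  | RAdd s t => RAdd (R_sgn_term s) (R_sgn_term t)
  | RScale k s => RScale k (R_sgn_term s)
  | ROne => ROne
  | RMul s t => RMul (R_sgn_term s) (R_sgn_term t)
  | RGen c i j => RScale ((-1) ^ (ab_deg c).1) (RGen c i j)
  end.

Definition R_sgn I (x : R I) : R I := R_cls (R_sgn_term (rep x)).

(** The odd derivation with prescribed values on the generators. *)
Fixpoint R_der_term (I : FiniteSet) (D : ab -> I -> I -> R_term K I) (t : R_term K I) :
    R_term K I :=
  match t with
  | RZero => RZero
  | RAdd s t => RAdd (R_der_term D s) (R_der_term D t)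
  | RScale k s => RScale k (R_der_term D s)
  | ROne => RZero
  | RMul s t => RAdd (RMul (R_der_term D s) t) (RMul (R_sgn_term s) (R_der_term D t))
  | RGen c i j => D c i j
  end.

Definition R_d I (x : R I) : R I :=
  R_cls (R_der_term (fun c i j => if c is ga then RGen gb i j else RZero) (rep x)).

Definition R_d' I (x : R I) : R I :=
  R_cls (R_der_term (fun c i j => if c is gb then RGen ga i j else RZero) (rep x)).

Definition R_even I (x : R I) : R I := 2^-1 *: (x + R_sgn x).
Definition R_odd I (x : R I) : R I := 2^-1 *: (x - R_sgn x).

(** [(u (x) v)(u' (x) v') = (-1)^{|v||u'|} uu' (x) vv'], the sign being handled by
    splitting [v] into its even and odd parts. *)
Definition R_tens_mul I J (s t : tensor (R I) (R J)) : tensor (R I) (R J) :=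
  tens_lift (fun (u : R I) (v : R J) => tens_lift (fun (u' : R I) (v' : R J) =>
    tens (u * u') (R_even v * v') + tens (u * R_sgn u') (R_odd v * v')) t) s.

(** [option I] stands for [I] with an additional element [None], the point [*]. The last
    case is forced by antisymmetry. *)
Definition Theta_gen (I J : FiniteSet) (c : ab) (u v : I + J) :
    tensor (R (option I)) (R J) :=
  match u, v with
  | inl i, inl j => tens (R_gen c (Some i) (Some j)) (1 : R J)
  | inr i, inr j => tens (1 : R (option I)) (R_gen c i j)
  | inl i, inr _ => tens (R_gen c (Some i) None) (1 : R J)
  | inr _, inl j => tens (R_gen c None (Some j)) (1 : R J)
  end.

Fixpoint Theta_term (I J : FiniteSet) (t : R_term K (I + J)%type) :
    tensor (R (option I)) (R J) :=
  match t with
  | RZero => 0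
  | RAdd s t => Theta_term s + Theta_term t
  | RScale k s => k *: Theta_term s
  | ROne => tens (1 : R (option I)) (1 : R J)
  | RMul s t => R_tens_mul (Theta_term s) (Theta_term t)
  | RGen c u v => Theta_gen c u v
  end.

Definition Theta (I J : FiniteSet) (x : R (I + J)%type) : tensor (R (option I)) (R J) :=
  Theta_term (rep x).

Fixpoint R_map_term (I J : FiniteSet) (s : I -> J) (t : R_term K I) : R_term K J :=
  match t with
  | RZero => RZero
  | RAdd t u => RAdd (R_map_term s t) (R_map_term s u)
  | RScale k t => RScale k (R_map_term s t)
  | ROne => ROne
  | RMul t u => RMul (R_map_term s t) (R_map_term s u)
  | RGen c i j => RGen c (s i) (s j)
  end.

Definition R_map (I J : FiniteSet) (s : bij I J) (x : R I) : R J :=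
  R_cls (R_map_term s (rep x)).

(** * The dual R^* *)

Definition Rdual (I : FiniteSet) := {linear R I -> K^o}.

Definition Rdual_homog I (p : bideg) (f : Rdual I) : Prop :=
  forall q (x : R I), q != p -> R_homog q x -> f x = 0.

(** Transport along [s : I -> J], i.e. the transpose of [R_map s^-1]. *)
Definition Rdual_map I J (s : bij I J) (f : Rdual I) : R J -> K :=
  fun y => f (R_map (bij_symm s) y).

Definition Rdual_comp (I J : FiniteSet) (f : Rdual (option I)) (g : Rdual J) :
    R (I + J)%type -> K := fun x => tens_form f g (Theta x).

(** [1^*], [a_{i,j}^*] and [b_{i,j}^*] in [R^*({i,j})]: the elements of the basis dual
    to the basis [1, a_{i,j}, b_{i,j}] of [R({i,j})]. *)
Definition is_one_star (I : FiniteSet) (i j : I) (f : Rdual I) : Prop :=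
  [/\ f 1 = 1, f (R_gen ga i j) = 0 & f (R_gen gb i j) = 0].
Definition is_a_star (I : FiniteSet) (i j : I) (f : Rdual I) : Prop :=
  [/\ f 1 = 0, f (R_gen ga i j) = 1 & f (R_gen gb i j) = 0].
Definition is_b_star (I : FiniteSet) (i j : I) (f : Rdual I) : Prop :=
  [/\ f 1 = 0, f (R_gen ga i j) = 0 & f (R_gen gb i j) = 1].

End Rstructure.
Arguments Rdual K I : clear implicits.

(** * The operad Ram *)

Section Bijections.
Context (I J L : FiniteSet).

Definition bij_option (s : bij I J) : bij (option I) (option J).
Proof.
by exists (omap s) (omap (bij_inv s)) => [] [x|] //=; rewrite (bij_funK, bij_invK).
Defined.

Definition bij_sum (I' J' : FiniteSet) (s : bij I I') (t : bij J J') :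
    bij (I + J)%type (I' + J')%type.
Proof.
exists (fun x => match x with inl i => inl (s i) | inr j => inr (t j) end)
       (fun x => match x with inl i => inl (bij_inv s i) | inr j => inr (bij_inv t j) end);
  by case=> x; rewrite (bij_funK, bij_invK).
Defined.

(** In a sum one of whose summands is pointed, that point becomes the point of the sum. *)
Definition bij_optl : bij (option I + J)%type (option (I + J)%type).
Proof.
exists (fun x => match x with
                 | inl (Some i) => Some (inl i) | inl None => None | inr j => Some (inr j)
                 end)
       (fun x => match x with
                 | Some (inl i) => inl (Some i) | None => inl None | Some (inr j) => inr j
                 end).
- by case=> [[i|]|j].
- by case=> [[i|j]|].
Defined.

Definition bij_optr : bij (I + option J)%type (option (I + J)%type).
Proof.
exists (fun x => match x with
                 | inl i => Some (inl i) | inr None => None | inr (Some j) => Some (inr j)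
                 end)
       (fun x => match x with
                 | Some (inl i) => inl i | None => inr None | Some (inr j) => inr (Some j)
                 end).
- by case=> [i|[j|]].
- by case=> [[i|j]|].
Defined.

Definition bij_assoc : bij (I + (J + L))%type ((I + J) + L)%type.
Proof.
exists (fun x => match x with
                 | inl i => inl (inl i) | inr (inl j) => inl (inr j) | inr (inr l) => inr l
                 end)
       (fun x => match x with
                 | inl (inl i) => inl i | inl (inr j) => inr (inl j) | inr l => inr (inr l)
                 end).
- by case=> [i|[j|l]].
- by case=> [[i|j]|l].
Defined.

Definition bij_sumAC : bij ((I + L) + J)%type ((I + J) + L)%type.
Proof.
exists (fun x => match x with
                 | inl (inl i) => inl (inl i) | inr j => inl (inr j) | inl (inr l) => inr l
                 end)
       (fun x => match x with
                 | inl (inl i) => inl (inl i) | inl (inr j) => inr j | inr l => inl (inr l)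
                 end).
- by case=> [[i|l]|j].
- by case=> [[i|j]|l].
Defined.

Definition bij_optC : bij (option (option I)) (option (option I)).
Proof.
exists (fun x => match x with Some None => None | None => Some None | _ => x end)
       (fun x => match x with Some None => None | None => Some None | _ => x end);
  by case=> [[i|]|].
Defined.

Definition bij_unitl : bij (void + J)%type J.
Proof.
exists (fun x : void + J => match x with inl v => of_void J v | inr j => j end) inr => //.
by case=> [[]|].
Defined.

Definition bij_unitr : bij (I + unit)%type (option I).
Proof.
exists (fun x => match x with inl i => Some i | inr _ => None end)
       (fun x => match x with Some i => inl i | None => inr tt end).
- by case=> [|[]].
- by case.
Defined.

End Bijections.

Definition bij_point : bij unit (option void).
Proof. by exists (fun=> None) (fun=> tt); case=> //; case. Defined.

Definition bij_negb : bij bool bool := Bij negbK negbK.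

(** In the following three bijections, the three elements [inl tt], [inr false],
    [inr true] of [unit + bool] play the roles of [i], [j], [k]. *)

(** [false] to [i], [true] to [*]. *)
Definition bij_istar : bij bool (option unit).
Proof.
exists (fun x => if x then None else Some tt) (fun x => if x is None then true else false).
- by case.
- by case=> [[]|].
Defined.

(** [i] to [j], [j] to [k], [k] to [i]. *)
Definition bij_rot : bij (unit + bool)%type (unit + bool)%type.
Proof.
exists (fun x => match x with
                 | inl _ => inr false | inr false => inr true | inr true => inl tt
                 end)
       (fun x => match x with
                 | inl _ => inr true | inr false => inl tt | inr true => inr false
                 end); by case=> [[]|[]].
Defined.

(** [i] to [j], [j] to [i], [k] to [k]. *)
Definition bij_swap : bij (unit + bool)%type (unit + bool)%type.
Proof.
exists (fun x => match x with
                 | inl _ => inr false | inr false => inl tt | inr true => inr true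
                 end)
       (fun x => match x with
                 | inl _ => inr false | inr false => inl tt | inr true => inr true
                 end); by case=> [[]|[]].
Defined.

Inductive ram_gen := gE | gL | gOmega.

Definition ram_gen_deg (g : ram_gen) : bideg :=
  match g with gE => (0, 0) | gL => (0, 1) | gOmega => (1, 1) end.

(** [MGen g] is [g_{false,true}] in arity [bool]; [MComp x y] is [x] composed with [y]
    at the point [None] of [x]. *)
Inductive ram_term (K : Type) : FiniteSet -> Type :=
| MZero I : ram_term K I
| MAdd I : ram_term K I -> ram_term K I -> ram_term K I
| MScale I : K -> ram_term K I -> ram_term K I
| MMap I J : bij I J -> ram_term K I -> ram_term K J
| MId : ram_term K unit
| MComp (I J : FiniteSet) : ram_term K (option I) -> ram_term K J -> ram_term K (I + J)%type
| MGen : ram_gen -> ram_term K bool.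
Arguments MZero {K I}.
Arguments MId {K}.
Arguments MGen {K}.

Inductive ram_hdeg (K : Type) : forall I : FiniteSet, bideg -> ram_term K I -> Prop :=
| MhZero I p : ram_hdeg p (@MZero K I)
| MhAdd I p (x y : ram_term K I) :
    ram_hdeg p x -> ram_hdeg p y -> ram_hdeg p (MAdd x y)
| MhScale I p k (x : ram_term K I) : ram_hdeg p x -> ram_hdeg p (MScale k x)
| MhMap I J p (s : bij I J) (x : ram_term K I) : ram_hdeg p x -> ram_hdeg p (MMap s x)
| MhId : ram_hdeg (0, 0) (@MId K)
| MhComp (I J : FiniteSet) p q (x : ram_term K (option I)) (y : ram_term K J) :
    ram_hdeg p x -> ram_hdeg q y -> ram_hdeg (p + q) (MComp x y)
| MhGen g : ram_hdeg (ram_gen_deg g) (@MGen K g).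

Section Ram.
Context {K : fieldType}.
Notation T := (ram_term K).

(** [g_{i,*} o_* h_{j,k}]. *)
Definition comp3 (g h : ram_gen) : T (unit + bool)%type :=
  MComp (MMap bij_istar (MGen g)) (MGen h).

Definition cycl (x : T (unit + bool)%type) : T (unit + bool)%type :=
  MAdd x (MAdd (MMap bij_rot x) (MMap bij_rot (MMap bij_rot x))).

(** Linearity, functoriality, the axioms of partial compositions (with the Koszul sign
    in the parallel axiom), and the defining relations of Ram. *)
Record ram_congr (E : forall I, T I -> T I -> Prop) : Prop := RamCongr {
  mc_lmod : forall I, lmod_congr MZero (@MAdd K I) (@MScale K I) (@E I);
  mc_map : forall I J (s : bij I J) x x', E I x x' -> E J (MMap s x) (MMap s x');
  mc_mapD : forall I J (s : bij I J) x y,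
    E J (MMap s (MAdd x y)) (MAdd (MMap s x) (MMap s y));
  mc_mapZ : forall I J (s : bij I J) k x,
    E J (MMap s (MScale k x)) (MScale k (MMap s x));
  mc_map_id : forall I x, E I (MMap (bij_id I) x) x;
  mc_map_comp : forall I J L (s : bij I J) (t : bij J L) (u : bij I L) x,
    u =1 t \o s -> E L (MMap t (MMap s x)) (MMap u x);
  mc_comp : forall (I J : FiniteSet) (x x' : T (option I)) (y y' : T J),
    E _ x x' -> E _ y y' -> E _ (MComp x y) (MComp x' y');
  mc_compDl : forall (I J : FiniteSet) (x x' : T (option I)) (y : T J),
    E _ (MComp (MAdd x x') y) (MAdd (MComp x y) (MComp x' y));
  mc_compDr : forall (I J : FiniteSet) (x : T (option I)) (y y' : T J),
    E _ (MComp x (MAdd y y')) (MAdd (MComp x y) (MComp x y'));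
  mc_compZl : forall (I J : FiniteSet) k (x : T (option I)) (y : T J),
    E _ (MComp (MScale k x) y) (MScale k (MComp x y));
  mc_compZr : forall (I J : FiniteSet) k (x : T (option I)) (y : T J),
    E _ (MComp x (MScale k y)) (MScale k (MComp x y));
  mc_equiv : forall (I I' J J' : FiniteSet) (s : bij I I') (t : bij J J') (x : T (option I)) (y : T J),
    E _ (MComp (MMap (bij_option s) x) (MMap t y)) (MMap (bij_sum s t) (MComp x y));
  mc_seq : forall (I J L : FiniteSet) (x : T (option I)) (y : T (option J)) (z : T L),
    E _ (MComp (MMap (bij_optr I J) (MComp x y)) z)
        (MMap (bij_assoc I J L) (MComp x (MComp y z)));
  mc_par : forall (I J L : FiniteSet) p q (x : T (option (option I))) (y : T J) (z : T L),
    ram_hdeg p y -> ram_hdeg q z ->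
    E _ (MComp (MMap (bij_optl I J) (MComp x y)) z)
        (MScale (koszul K p q) (MMap (bij_sumAC I J L)
          (MComp (MMap (bij_optl I L) (MComp (MMap (bij_optC I) x) z)) y)));
  mc_unitl : forall J (y : T J),
    E _ (MMap (bij_unitl J) (MComp (MMap bij_point MId) y)) y;
  mc_unitr : forall (I : FiniteSet) (x : T (option I)), E _ (MMap (bij_unitr I) (MComp x MId)) x;
  mc_symE : E _ (MMap bij_negb (MGen gE)) (MGen gE);
  mc_symL : E _ (MMap bij_negb (MGen gL)) (MScale (-1) (MGen gL));
  mc_symO : E _ (MMap bij_negb (MGen gOmega)) (MScale (-1) (MGen gOmega));
  mc_EE : E _ (comp3 gE gE) (MMap bij_rot (comp3 gE gE));
  mc_LL : E _ (cycl (comp3 gL gL)) MZero;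
  mc_OL : E _ (cycl (MAdd (comp3 gOmega gL) (comp3 gL gOmega))) MZero;
  mc_LE : E _ (comp3 gL gE)
    (MAdd (MMap bij_swap (comp3 gE gL)) (MMap bij_rot (MMap bij_rot (comp3 gE gL))));
  mc_OE : E _ (comp3 gOmega gE)
    (MAdd (MMap bij_swap (comp3 gE gOmega))
          (MMap bij_rot (MMap bij_rot (comp3 gE gOmega)))) }.

Definition ram_eqv I (x y : T I) : Prop := forall E, ram_congr E -> E I x y.

Lemma ram_eqv_lmod I : lmod_congr MZero (@MAdd K I) (@MScale K I) (@ram_eqv I).
Proof. by apply: (meet_lmod_congr (E := fun E => E I)) => E /mc_lmod. Qed.

Definition ram_pres I := LmodPresentation (ram_eqv_lmod I).

Definition Ram I : lmodType K := lmod_quot (ram_pres I).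

Definition ram_cls I (x : T I) : Ram I := cls (M := ram_pres I) x.

Definition ram_rep I (r : Ram I) : T I := rep (M := ram_pres I) r.

Definition ram_homog I (p : bideg) (r : Ram I) : Prop :=
  exists2 x : T I, ram_hdeg p x & r = ram_cls x.

Definition ram_map I J (s : bij I J) (r : Ram I) : Ram J := ram_cls (MMap s (ram_rep r)).

Definition ram_id : Ram unit := ram_cls MId.

Definition ram_comp (I J : FiniteSet) (r : Ram (option I)) (s : Ram J) : Ram (I + J)%type :=
  ram_cls (MComp (ram_rep r) (ram_rep s)).

(** [g_{i,j}] in [Ram({i,j})], for [i = s false] and [j = s true]. *)
Definition ram_g I (g : ram_gen) (s : bij bool I) : Ram I := ram_map s (ram_cls (MGen g)).

(** The parity involution, [x] to [(-1)^{|x|} x]. *)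
Fixpoint ram_sgn_term I (x : T I) : T I :=
  match x with
  | MZero _ => MZero
  | MAdd _ x y => MAdd (ram_sgn_term x) (ram_sgn_term y)
  | MScale _ k x => MScale k (ram_sgn_term x)
  | MMap _ _ s x => MMap s (ram_sgn_term x)
  | MId => MId
  | MComp _ _ x y => MComp (ram_sgn_term x) (ram_sgn_term y)
  | MGen g => MScale ((-1) ^ (ram_gen_deg g).1) (MGen g)
  end.

Definition ram_sgn I (r : Ram I) : Ram I := ram_cls (ram_sgn_term (ram_rep r)).

(** The odd derivation for composition with prescribed values on the generators. *)
Fixpoint ram_der_term (D : ram_gen -> T bool) I (x : T I) : T I :=
  match x with
  | MZero _ => MZero
  | MAdd _ x y => MAdd (ram_der_term D x) (ram_der_term D y)
  | MScale _ k x => MScale k (ram_der_term D x)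
  | MMap _ _ s x => MMap s (ram_der_term D x)
  | MId => MZero
  | MComp _ _ x y =>
      MAdd (MComp (ram_der_term D x) y) (MComp (ram_sgn_term x) (ram_der_term D y))
  | MGen g => D g
  end.

Definition ram_D I (r : Ram I) : Ram I :=
  ram_cls (ram_der_term (fun g => if g is gOmega then MGen gL else MZero) (ram_rep r)).

Definition ram_D' I (r : Ram I) : Ram I :=
  ram_cls (ram_der_term (fun g => if g is gL then MGen gOmega else MZero) (ram_rep r)).

Definition ram_even I (r : Ram I) : Ram I := 2^-1 *: (r + ram_sgn r).
Definition ram_odd I (r : Ram I) : Ram I := 2^-1 *: (r - ram_sgn r).

(** [(x (x) x') o (y (x) y') = (-1)^{|x'||y|} (x o y) (x) (x' o y')], the sign being
    handled as in [R_tens_mul]. *)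
Definition ram_tens_comp (I J : FiniteSet) (s : tensor (Ram (option I)) (Ram (option I)))
    (t : tensor (Ram J) (Ram J)) : tensor (Ram (I + J)%type) (Ram (I + J)%type) :=
  tens_lift (fun x x' => tens_lift (fun y y' =>
    tens (ram_comp x y) (ram_comp (ram_even x') y') +
    tens (ram_comp x (ram_sgn y)) (ram_comp (ram_odd x') y')) t) s.

Definition ram_coprod_gen (g : ram_gen) : tensor (Ram bool) (Ram bool) :=
  let e := ram_cls (MGen gE) in let x := ram_cls (MGen g) in
  if g is gE then tens e e else tens e x + tens x e.

Fixpoint ram_coprod_term I (x : T I) : tensor (Ram I) (Ram I) :=
  match x with
  | MZero _ => 0
  | MAdd _ x y => ram_coprod_term x + ram_coprod_term y
  | MScale _ k x => k *: ram_coprod_term x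
  | MMap _ _ s x => tens_lift (fun y z => tens (ram_map s y) (ram_map s z)) (ram_coprod_term x)
  | MId => tens ram_id ram_id
  | MComp _ _ x y => ram_tens_comp (ram_coprod_term x) (ram_coprod_term y)
  | MGen g => ram_coprod_gen g
  end.

Definition ram_coprod I (r : Ram I) : tensor (Ram I) (Ram I) :=
  ram_coprod_term (ram_rep r).

Fixpoint ram_counit_term I (x : T I) : K :=
  match x with
  | MZero _ => 0
  | MAdd _ x y => ram_counit_term x + ram_counit_term y
  | MScale _ k x => k * ram_counit_term x
  | MMap _ _ s x => ram_counit_term x
  | MId => 1
  | MComp _ _ x y => ram_counit_term x * ram_counit_term y
  | MGen g => if g is gE then 1 else 0
  end.

Definition ram_counit I (r : Ram I) : K := ram_counit_term (ram_rep r).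

End Ram.
Arguments Ram K I : clear implicits.

(** * Maps from Ram to R^* *)

Section Maps.
Context {K : fieldType}.

(** The unit of R^* is the functional [1^*] on the one-dimensional algebra R({x}), its
    counit is evaluation at 1, and its coproduct, the transpose of the product of R(I),
    is characterised by the pairing with [x (x) y]. *)
Record is_hopf_operad_map (rho : forall I, Ram K I -> Rdual K I) : Prop := IsHopfOperadMap {
  hm_linear : forall I k (r s : Ram K I) x,
    rho I (k *: r + s) x = k * rho I r x + rho I s x;
  hm_homog : forall I p (r : Ram K I), ram_homog p r -> Rdual_homog p (rho I r);
  hm_map : forall I J (s : bij I J) (r : Ram K I),
    rho J (ram_map s r) =1 Rdual_map s (rho I r);
  hm_id : rho unit ram_id 1 = 1;
  hm_comp : forall (I J : FiniteSet) (r : Ram K (option I)) (s : Ram K J),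
    rho _ (ram_comp r s) =1 Rdual_comp (rho _ r) (rho _ s);
  hm_coprod : forall I (r : Ram K I) (x y : Ralg K I),
    tens_lift (fun r1 r2 => (rho I r1 x * rho I r2 y : K^o)) (ram_coprod r)
      = rho I r (x * y);
  hm_counit : forall I (r : Ram K I), ram_counit r = rho I r 1 }.

Definition on_generators (rho : forall I, Ram K I -> Rdual K I) : Prop :=
  forall (I : FiniteSet) (s : bij bool I), let i := s false in let j := s true in
  [/\ is_one_star i j (rho I (ram_g gE s)),
      is_b_star i j (rho I (ram_g gOmega s)) &
      is_a_star i j (rho I (ram_g gL s))].

(** The transpose of a map, acting on functionals. *)
Definition transpose (U V : Type) (f : U -> V) (phi : V -> K) : U -> K := phi \o f.

(** The transpose [R(I) -> Ram(I)^*] of [rho]. *)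
Definition rho_star (rho : forall I, Ram K I -> Rdual K I) I (x : Ralg K I) : Ram K I -> K :=
  fun r => rho I r x.

End Maps.

(* Main.v *)
(** [R(I)] is spanned by words in the letters [a_{i,j}], [b_{i,j}], and the cocomposition
    maps each word to a signed pure tensor of words. A functional on [R(I)] is thus a
    function on words killing the relations of [R(I)], and the composition of two such
    functions is explicit. What has to be proved is that composing two functions that kill
    the relations yields such a function: the outer part of a closed walk, if nonempty, is
    a closed walk, and the twelve-word relations are invariant under permutations of their
    four indices, so that the indices in the inner set may be taken first. Once this is
    known, [rho] is defined by recursion on formal composites; the operad axioms, the
    relations of Ram, and the compatibility with the coproducts and the differentials are
    identities between functions on words, proved by induction. Uniqueness holds since
    Ram is generated by [E], [L], [Omega]. *)

From HB Require Import structures.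
Require Import Defs.
From mathcomp Require Import all_boot all_order all_algebra boolp reals ring zify.
From mathcomp.real_closed Require Import complex.
Set Implicit Arguments.
Unset Strict Implicit.
Unset Printing Implicit Defensive.
Import GRing.Theory.
Local Open Scope ring_scope.

(** * Tensor products *)

(** The structure maps are computed on [rep], a chosen expression, so nothing can be evaluated on
    the quotients before independence of that choice is known. This is what admissibility provides:
    for [f] with [adm f], the value [lin t f] depends only on the class of [t], so admissible
    functions with values in [V] amount to linear maps from R(I) to [V]. Targets other than the
    field are allowed so that the monomial classes [wcls] are themselves an admissible function,
    through which every functional is read on words. R(I) is a quotient by a two-sided ideal, so
    relations must be killed inside every context. For composites the context is absorbed into
    signs, and each relation is then checked by distributing its indices between I and J. The
    symmetry of the twelve-word sums is needed before the composite is known to be admissible; it is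
    therefore derived from commutation and antisymmetry alone, which are proved first. Koszul signs
    on tensors are implemented by even and odd parts, hence the recurring hypothesis that 2 is
    nonzero. *)

Section TensorLift.
Context {K : fieldType} {U V W : lmodType K}.

(** All three folds run over the same representative [rep t], so this holds for arbitrary functions,
    bilinear or not. *)
Lemma tens_lift_comb (B B1 B2 : U -> V -> W) k t :
  (forall u v, B u v = k *: B1 u v + B2 u v) ->
  tens_lift B t = k *: tens_lift B1 t + tens_lift B2 t.
Proof.
move=> H; rewrite /tens_lift; elim: (rep t) => //= [|s -> s' ->|l s ->].
- by rewrite scaler0 addr0.
- by rewrite scalerDr addrACA.
- by rewrite scalerDr !scalerA mulrC.
Qed.

Lemma eq_tens_lift (B B' : U -> V -> W) (t : tensor U V) :
  (forall u v, B u v = B' u v) -> tens_lift B t = tens_lift B' t.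
Proof. by move=> H; rewrite /tens_lift; elim: (rep t) => //= [|k] s -> // s' ->. Qed.

Lemma tens_lift_linear (W' : lmodType K) (h : W -> W') (B : U -> V -> W) (t : tensor U V) :
  (forall k x y, h (k *: x + y) = k *: h x + h y) ->
  h (tens_lift B t) = tens_lift (fun u v => h (B u v)) t.
Proof.
move=> hl.
have h0 : h 0 = 0 by have := hl (-1) 0 0; rewrite scaler0 addr0 scaleN1r addNr.
rewrite /tens_lift; elim: (rep t) => //= [s IHs s' IHs'|k s IH].
- by rewrite -[tens_fold B s]scale1r hl IHs IHs' scale1r.
- by rewrite -[k *: tens_fold B s]addr0 hl h0 addr0 IH.
Qed.

Lemma tens_lift_scale (B : U -> V -> W) k (t : tensor U V) :
  tens_lift (fun u v => k *: B u v) t = k *: tens_lift B t.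
Proof.
rewrite (tens_lift_linear (h := fun x => k *: x)) // => l x y.
by rewrite scalerDr !scalerA mulrC.
Qed.

Context (B : U -> V -> W).
Hypothesis BDl : forall k u u' v, B (k *: u + u') v = k *: B u v + B u' v.
Hypothesis BDr : forall k u v v', B u (k *: v + v') = k *: B u v + B u v'.

(** Bilinearity makes equality of folds one of the congruences intersected in [tens_eqv], whence the
    universal property below. *)
Lemma tens_fold_congr : tens_congr (fun s t => tens_fold B s = tens_fold B t).
Proof.
have B0l v : B 0 v = 0 by have := BDl (-1) 0 0 v; rewrite scaler0 addr0 scaleN1r addNr.
have B0r u : B u 0 = 0 by have := BDr (-1) u 0 0; rewrite scaler0 addr0 scaleN1r addNr.
split=> [|u u' v|u v v'|k u v|k u v] /=; last 1 first.
- by rewrite -[k *: v]addr0 BDr B0r addr0.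
- split=> //=.
  + by move=> x y z -> ->.
  + by move=> x x' y y' -> ->.
  + by move=> k x x' ->.
  + by move=> x y z; rewrite addrA.
  + by move=> x y; rewrite addrC.
  + by move=> x; rewrite add0r.
  + by move=> x; rewrite scaleN1r addNr.
  + by move=> k l x; rewrite scalerA.
  + by move=> x; rewrite scale1r.
  + by move=> k x y; rewrite scalerDr.
  + by move=> k l x; rewrite scalerDl.
- by rewrite -[in LHS](scale1r u) BDl scale1r.
- by rewrite -[in LHS](scale1r v) BDr scale1r.
- by rewrite -[k *: u]addr0 BDl B0l addr0.
Qed.

Lemma tens_liftE s : tens_lift B (cls s : tensor U V) = tens_fold B s.
Proof. exact: (rep_cls (M := tens_pres U V) s _ tens_fold_congr). Qed.

Lemma tens_lift_tens u v : tens_lift B (tens u v) = B u v.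
Proof. exact: (tens_liftE (TPure u v)). Qed.

Lemma tens_liftD s t : tens_lift B (s + t) = tens_lift B s + tens_lift B t.
Proof.
rewrite -[s](repK (M := tens_pres U V)) -[t](repK (M := tens_pres U V)).
by rewrite -(clsD (M := tens_pres U V)) !tens_liftE.
Qed.

Lemma tens_liftZ k s : tens_lift B (k *: s) = k *: tens_lift B s.
Proof.
by rewrite -[s](repK (M := tens_pres U V)) -(clsZ (M := tens_pres U V)) !tens_liftE.
Qed.

End TensorLift.

Section TensBilinear.
Context {K : fieldType} {U V : lmodType K}.

Lemma tensDl (k : K) (u u' : U) (v : V) :
  tens (k *: u + u') v = k *: tens u v + tens u' v.
Proof.
rewrite -(clsZ (M := tens_pres U V)) -(clsD (M := tens_pres U V)).
apply/(clsP (M := tens_pres U V)) => E hE.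
apply: (lc_trans hE (tc_addl hE _ _ _)); apply: (lc_add hE); last exact: (lc_refl hE).
exact: (tc_scalel hE).
Qed.

Lemma tensDr (k : K) (u : U) (v v' : V) :
  tens u (k *: v + v') = k *: tens u v + tens u v'.
Proof.
rewrite -(clsZ (M := tens_pres U V)) -(clsD (M := tens_pres U V)).
apply/(clsP (M := tens_pres U V)) => E hE.
apply: (lc_trans hE (tc_addr hE _ _ _)); apply: (lc_add hE); last exact: (lc_refl hE).
exact: (tc_scaler hE).
Qed.

Lemma tens0r (u : U) : tens u (0 : V) = 0.
Proof. by have := tensDr (-1) u 0 0; rewrite scaler0 addr0 scaleN1r addNr. Qed.

Lemma tensZr (k : K) (u : U) (v : V) : tens u (k *: v) = k *: tens u v.
Proof. by rewrite -[k *: v]addr0 tensDr tens0r addr0. Qed.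

Lemma tens0l (v : V) : tens (0 : U) v = 0.
Proof. by have := tensDl (-1) 0 0 v; rewrite scaler0 addr0 scaleN1r addNr. Qed.

Lemma tensZl (k : K) (u : U) (v : V) : tens (k *: u) v = k *: tens u v.
Proof. by rewrite -[k *: u]addr0 tensDl tens0l addr0. Qed.

End TensBilinear.

(** * Words *)

Definition edge (I : FiniteSet) : Type := (ab * I * I)%type.
Notation word I := (seq (edge I)).

Section Words.
Context {I : FiniteSet}.

Definition eodd (e : edge I) : bool := if e.1.1 is gb then true else false.
Definition wodd (w : word I) : bool := foldr (fun e => addb (eodd e)) false w.
Definition wdeg (w : word I) : bideg := \sum_(e <- w) ab_deg e.1.1.

Lemma wodd_cat u v : wodd (u ++ v) = wodd u (+) wodd v.
Proof. by elim: u => //= e u ->; rewrite addbA. Qed.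

Lemma wdeg_cons e w : wdeg (e :: w) = ab_deg e.1.1 + wdeg w.
Proof. by rewrite /wdeg big_cons. Qed.

Lemma wdeg_cat u v : wdeg (u ++ v) = wdeg u + wdeg v.
Proof. by rewrite /wdeg big_cat. Qed.

(** Links the integer exponents of [koszul] with the boolean parities that carry all signs on
    words. *)
Lemma wdeg_odd (w : word I) : exists2 n, (wdeg w).1 = Posz n & odd n = wodd w.
Proof.
elim: w => [|[[c i] j] w [n Hn Ho]]; first by exists 0 => //; rewrite /wdeg big_nil.
rewrite wdeg_cons /= Hn; case: c => /=; first by exists n; rewrite ?add0r.
by exists n.+1; rewrite //= Ho.
Qed.

(** The word [c1_{x,x1} c2_{x1,x2} ..] for [p = [:: (c1, x1); (c2, x2); ..]]. *)
Fixpoint walk (x : I) (p : seq (ab * I)) : word I :=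
  if p is (c, y) :: p' then (c, x, y) :: walk y p' else [::].

Lemma walk_cat x p q : walk x (p ++ q) = walk x p ++ walk (last x (unzip2 p)) q.
Proof. by elim: p x => //= -[c y] p IH x /=; rewrite IH. Qed.

Definition bpath (s : seq I) : seq (ab * I) := [seq (gb, x) | x <- s].

Definition path4 (c : ab) (w : I * I * I * I) : word I :=
  let: (w1, w2, w3, w4) := w in [:: (gb, w1, w2); (c, w2, w3); (gb, w3, w4)].

(** The defining relations of [R(I)], each stating that the sum of a list of words is 0. *)
Inductive Rrel : seq (word I) -> Prop :=
| rel_diag c i : Rrel [:: [:: (c, i, i)]]
| rel_anti c i j : i != j -> Rrel [:: [:: (c, j, i)]; [:: (c, i, j)]]
| rel_aa i j : i != j -> Rrel [:: [:: (ga, i, j); (ga, i, j)]]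
| rel_arnold i j k : uniq [:: i; j; k] ->
    Rrel [:: [:: (ga, i, j); (ga, j, k)]; [:: (ga, j, k); (ga, k, i)];
             [:: (ga, k, i); (ga, i, j)]]
| rel_mixed i j k : uniq [:: i; j; k] ->
    Rrel [:: [:: (gb, i, j); (ga, j, k)]; [:: (gb, j, k); (ga, k, i)];
             [:: (gb, k, i); (ga, i, j)]; [:: (ga, i, j); (gb, j, k)];
             [:: (ga, j, k); (gb, k, i)]; [:: (ga, k, i); (gb, i, j)]]
| rel_cycle c i0 i1 s : uniq [:: i0, i1 & s] ->
    Rrel [:: walk i0 ((c, i1) :: bpath (rcons s i0))]
| rel_path c i j k l : uniq [:: i; j; k; l] ->
    Rrel [seq path4 c w | w <- words4 i j k l].

End Words.

(** * Linear extension of functions on words, and admissible functions *)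

Section LinearExtension.
Context {K : fieldType} {I : FiniteSet}.

Lemma koszul_wdeg (J : FiniteSet) (u : word I) (v : word J) :
  koszul K (wdeg u) (wdeg v) = (-1) ^+ (wodd u && wodd v).
Proof.
rewrite /koszul; have [n -> <-] := wdeg_odd u; have [m -> <-] := wdeg_odd v.
by rewrite -PoszM -exprnP -oddM signr_odd.
Qed.

(** Value of [t], read as a noncommutative polynomial, under the linear extension of [f]. The
    continuation style avoids expanding products into lists of words. *)
Fixpoint lin (V : lmodType K) (t : R_term K I) (f : word I -> V) : V :=
  match t with
  | RZero => 0
  | RAdd s t => lin s f + lin t f
  | RScale k s => k *: lin s f
  | ROne => f [::]
  | RMul s t => lin s (fun u => lin t (fun v => f (u ++ v)))
  | RGen c i j => f [:: (c, i, j)]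
  end.

Section Lin.
Context {V : lmodType K}.
Implicit Types (t : R_term K I) (f g : word I -> V).

Lemma eq_lin t f g : f =1 g -> lin t f = lin t g.
Proof.
elim: t f g => //= [s IHs t IHt|k s IH|s IHs t IHt] f g E;
  rewrite ?(IHs f g) ?(IHt f g) ?(IH f g) //.
by apply: IHs => u; apply: IHt => v; apply: E.
Qed.

Lemma lin_comb t k f g : lin t (fun w => k *: f w + g w) = k *: lin t f + lin t g.
Proof.
elim: t f g => //= [|s IHs t IHt|l s IH|s IHs t IHt] f g.
- by rewrite scaler0 addr0.
- by rewrite IHs IHt scalerDr addrACA.
- by rewrite IH scalerDr !scalerA [k * l]mulrC.
- by rewrite -IHs; apply: eq_lin => u; rewrite -IHt.
Qed.

Lemma lin0 t : lin t (fun=> 0 : V) = 0.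
Proof.
rewrite -[RHS](addNr (lin t (fun=> 0 : V))) -scaleN1r -lin_comb.
by apply: eq_lin => w; rewrite scaler0 addr0.
Qed.

Lemma linZ t k f : lin t (fun w => k *: f w) = k *: lin t f.
Proof.
rewrite -[RHS]addr0 -[in RHS](lin0 t) -lin_comb.
by apply: eq_lin => w; rewrite addr0.
Qed.

Lemma linD t f g : lin t (fun w => f w + g w) = lin t f + lin t g.
Proof. by rewrite -[lin t f]scale1r -lin_comb; apply: eq_lin => w; rewrite scale1r. Qed.

Lemma lin_sum (S : seq (R_term K I)) f : lin (R_sum S) f = \sum_(t <- S) lin t f.
Proof. by elim: S => [|t S IH] /=; rewrite ?big_nil // big_cons IH. Qed.

Lemma lin_b_chain i s f : lin (b_chain i s) f = f (walk i (bpath s)).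
Proof. by elim: s i f => //= j s IH i f; rewrite IH. Qed.

(** A homogeneous expression expands into words of its own degree only. *)
Lemma lin_hdeg p t f g :
  R_hdeg p t -> (forall w, wdeg w = p -> f w = g w) -> lin t f = lin t g.
Proof.
move=> h; elim: h f g => //=
  {p t} [p s t _ IHs _ IHt|p k t _ IH||p q s t _ IHs _ IHt|c i j] f g E.
- by rewrite (IHs f g) ?(IHt f g).
- by rewrite (IH f g).
- by apply: E; rewrite /wdeg big_nil.
- by apply: IHs => u Hu; apply: IHt => v Hv; apply: E; rewrite wdeg_cat Hu Hv.
- by apply: E; rewrite /wdeg big_seq1.
Qed.

End Lin.

Lemma lin_linear (V W : lmodType K) (h : V -> W) (t : R_term K I) (f : word I -> V) :
  (forall k x y, h (k *: x + y) = k *: h x + h y) -> h (lin t f) = lin t (h \o f).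
Proof.
move=> hl.
have h0 : h 0 = 0 by have := hl (-1) 0 0; rewrite scaler0 addr0 scaleN1r addNr.
have hD x y : h (x + y) = h x + h y by rewrite -[x in LHS]scale1r hl scale1r.
have hZ k x : h (k *: x) = k *: h x by rewrite -[k *: x]addr0 hl h0 addr0.
elim: t f => //= [s IHs t IHt|k s IH|s IHs t IHt] f.
- by rewrite hD IHs IHt.
- by rewrite hZ IH.
- by rewrite IHs; apply: eq_lin => u /=; rewrite IHt.
Qed.

(** A Fubini rule. The functional [h] is abstract because it serves both as [lin t], to exchange two
    expressions, and as [tens_lift], to exchange an expression with a tensor. *)
Lemma lin_exchange (T : Type) (V : lmodType K) (s : R_term K I) (F : word I -> T -> V)
    (h : (T -> V) -> V) :
  (forall f g, f =1 g -> h f = h g) ->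
  (forall k f g, h (fun v => k *: f v + g v) = k *: h f + h g) ->
  lin s (fun u => h (F u)) = h (fun v => lin s (fun u => F u v)).
Proof.
move=> he hl.
have h0 : h (fun=> 0) = 0.
  rewrite -[RHS](addNr (h (fun=> 0))) -scaleN1r -hl.
  by apply: he => v; rewrite scaler0 addr0.
elim: s F => //= [s IHs t IHt|k s IH|s IHs t IHt] F.
- rewrite IHs IHt -[X in X + _]scale1r -hl.
  by apply: he => v; rewrite scale1r.
- by rewrite IH -[LHS]addr0 -h0 -hl; apply: he => v; rewrite addr0.
- by rewrite -IHs; apply: eq_lin => u; rewrite -IHt.
Qed.

(** [f] descends to the quotient of the free algebra by the relations of [R(I)]. *)
Record adm (V : lmodType K) (f : word I -> V) : Prop := Adm {
  adm_comm : forall u v e1 e2,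
    f (u ++ e1 :: e2 :: v) = (-1) ^+ (eodd e1 && eodd e2) *: f (u ++ e2 :: e1 :: v);
  adm_rel : forall r, Rrel r -> forall u v, \sum_(w <- r) f (u ++ w ++ v) = 0 }.

Section Adm.
Context {V : lmodType K}.
Implicit Types (t : R_term K I) (f g : word I -> V).

Lemma adm_comm_cons f x e v y : adm f ->
  f (x ++ e :: v ++ y) = (-1) ^+ (eodd e && wodd v) *: f (x ++ v ++ e :: y).
Proof.
move=> fa; elim: v x => [|e' v IH] x /=; first by rewrite andbF scale1r.
rewrite (adm_comm fa) -cat_rcons IH cat_rcons scalerA -signr_addb.
by rewrite andb_addr.
Qed.

Lemma adm_comm_cat f x u v y : adm f ->
  f (x ++ u ++ v ++ y) = (-1) ^+ (wodd u && wodd v) *: f (x ++ v ++ u ++ y).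
Proof.
move=> fa; elim: u x => [|e u IH] x /=; first by rewrite scale1r.
rewrite -cat_rcons IH cat_rcons (adm_comm_cons _ _ _ _ fa) scalerA -signr_addb.
by rewrite andb_addl addbC.
Qed.

Lemma adm_lin f s t : adm f -> R_eqv s t -> lin s f = lin t f.
Proof.
move=> fa st.
(* All contexts are included so that the relation is stable under products; the empty context gives
   the claim. *)
suff H : R_congr (fun s t =>
    forall u v, lin s (fun w => f (u ++ w ++ v)) = lin t (fun w => f (u ++ w ++ v))).
  have := st _ H [::] [::]; rewrite (eq_lin s (g := f)); last by move=> w; rewrite cats0.
  by rewrite (eq_lin t (g := f)) // => w; rewrite cats0.
have rel0 r u v : Rrel r -> \sum_(w <- r) f (u ++ w ++ v) = 0 by move=> /(adm_rel fa).
split.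
- split=> //=.
  + by move=> x y z h1 h2 u v; rewrite h1.
  + by move=> x x' y y' h1 h2 u v; rewrite h1 h2.
  + by move=> k x x' h u v; rewrite h.
  + by move=> *; rewrite addrA.
  + by move=> *; rewrite addrC.
  + by move=> *; rewrite add0r.
  + by move=> *; rewrite scaleN1r addNr.
  + by move=> *; rewrite scalerA.
  + by move=> *; rewrite scale1r.
  + by move=> *; rewrite scalerDr.
  + by move=> *; rewrite scalerDl.
- move=> s1 s2 t1 t2 hs ht u v /=.
  (* The factors are replaced one at a time: [t1] with [u ++ x] on its left, then, after exchanging
     the sums, [s1] with [y ++ v] on its right. *)
  transitivity (lin s1 (fun x => lin t2 (fun y => f (u ++ (x ++ y) ++ v)))).
    apply: eq_lin => x; transitivity (lin t1 (fun y => f ((u ++ x) ++ y ++ v))).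
      by apply: eq_lin => y; rewrite !catA.
    by rewrite ht; apply: eq_lin => y; rewrite !catA.
  have ex s0 : lin s0 (fun x => lin t2 (fun y => f (u ++ (x ++ y) ++ v))) =
      lin t2 (fun y => lin s0 (fun x => f (u ++ x ++ (y ++ v)))).
    rewrite (lin_exchange s0 (fun x y => f (u ++ (x ++ y) ++ v)) (h := fun F => lin t2 F)).
    + by apply: eq_lin => y; apply: eq_lin => x; rewrite !catA.
    + by move=> *; apply: eq_lin.
    + by move=> *; rewrite lin_comb.
  by rewrite !ex; apply: eq_lin => y; rewrite hs.
- by move=> x y z u v /=; do 3![apply: eq_lin => ?]; rewrite !catA.
- by move=> *.
- by move=> x u v /=; apply: eq_lin => y; rewrite cats0.
- by move=> *.
- by move=> x y z u v /=; rewrite -linD.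
- by move=> *.
- by move=> k x y u v /=; rewrite -linZ.
- move=> p q x y hx hy u v /=.
  (* Only words of degrees [p] and [q] occur, so the sign of commuting them is constant. *)
  transitivity (lin x (fun a => lin y (fun b => koszul K p q *: f (u ++ (b ++ a) ++ v)))).
    apply: (lin_hdeg hx) => a <-; apply: (lin_hdeg hy) => b <-.
    by rewrite koszul_wdeg -!catA (adm_comm_cat _ _ _ _ fa).
  under eq_lin do rewrite linZ.
  rewrite linZ; congr (_ *: _).
  rewrite (lin_exchange x (fun a b => f (u ++ (b ++ a) ++ v)) (h := fun F => lin y F)) //.
  + by move=> *; apply: eq_lin.
  + by move=> *; rewrite lin_comb.
- by move=> c i u v /=; have := rel0 _ u v (rel_diag c i); rewrite big_seq1.
- move=> c i j ij u v /=; have := rel0 _ u v (rel_anti c ij).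
  by rewrite big_cons big_seq1 scaleN1r => /eqP; rewrite addr_eq0 => /eqP.
- by move=> i j ij u v /=; have := rel0 _ u v (rel_aa ij); rewrite big_seq1.
- move=> i j k ijk u v; have := rel0 _ u v (rel_arnold ijk).
  by rewrite lin_sum !big_cons !big_nil.
- move=> i j k ijk u v; have := rel0 _ u v (rel_mixed ijk).
  by rewrite lin_sum !big_cons !big_nil.
- move=> i0 i1 s0 hs u v; have := rel0 _ u v (rel_cycle ga hs).
  by rewrite big_seq1 /= lin_b_chain.
- move=> i0 i1 s0 hs u v; have := rel0 _ u v (rel_cycle gb hs).
  by rewrite big_seq1 /= lin_b_chain.
- move=> i j k l h u v; have := rel0 _ u v (rel_path ga h).
  by rewrite lin_sum !big_cons !big_nil.
- move=> i j k l h u v; have := rel0 _ u v (rel_path gb h).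
  by rewrite lin_sum !big_cons !big_nil.
Qed.

End Adm.
End LinearExtension.

(** * Stability properties of admissibility *)

Section AdmClosure.
Context {K : fieldType} {I : FiniteSet} {V : lmodType K}.
Implicit Types f g : word I -> V.

(** Relations are homogeneous for the parity, so a sign depending on the parity of the inserted word
    factors out of their sums. *)
Lemma Rrel_odd r : @Rrel I r -> exists b, all (fun w => wodd w == b) r.
Proof.
case=> {r} [c i|c i j _|i j _|i j k _|i j k _|c i0 i1 s _|c i j k l _].
- by exists (wodd [:: (c, i, i)]) => /=; rewrite eqxx.
- by exists (wodd [:: (c, i, j)]) => /=; rewrite eqxx.
- by exists false.
- by exists false.
- by exists true.
- by exists (wodd (walk i0 ((c, i1) :: bpath (rcons s i0)))); rewrite /= eqxx.
- by exists (wodd (path4 c (i, j, k, l))) => /=; rewrite !eqxx.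
Qed.

Lemma adm_ctx f (s : bool) x y : adm f ->
  adm (fun w => (-1) ^+ (s && wodd w) *: f (x ++ w ++ y)).
Proof.
move=> fa; split=> [u v e1 e2|r hr u v].
  rewrite -!catA !cat_cons !catA (adm_comm fa) !scalerA mulrC.
  by congr (_ * _ ^+ (_ && _) *: _); rewrite !wodd_cat /= (addbCA (eodd e1)).
have [b hb] := Rrel_odd hr.
transitivity (\sum_(w <- r)
    (-1) ^+ (s && (wodd u (+) b (+) wodd v)) *: f ((x ++ u) ++ w ++ v ++ y)).
  elim: r hb {hr} => [|w r IH] /=; first by rewrite !big_nil.
  case/andP=> /eqP Hb /IH E; rewrite !big_cons E; congr (_ *: f _ + _).
    by rewrite !wodd_cat Hb addbA.
  by rewrite -!catA.
by rewrite -scaler_sumr (adm_rel fa hr) scaler0.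
Qed.

Lemma adm_diag f c i u v : adm f -> f (u ++ (c, i, i) :: v) = 0.
Proof. by move=> fa; have := adm_rel fa (rel_diag c i) u v; rewrite big_seq1. Qed.

Lemma adm_anti f c i j u v : adm f -> f (u ++ (c, j, i) :: v) = - f (u ++ (c, i, j) :: v).
Proof.
move=> fa; have [->|ij] := eqVneq i j; first by rewrite adm_diag // oppr0.
have := adm_rel fa (rel_anti c ij) u v.
by rewrite big_cons big_seq1 => /eqP; rewrite addr_eq0 => /eqP.
Qed.

(** Serves for the generators and the operadic unit: all relations other than loops and antisymmetry
    involve only words of at least two letters. *)
Lemma adm_of_short f :
  (forall e1 e2 w, f (e1 :: e2 :: w) = 0) ->
  (forall c i, f [:: (c, i, i)] = 0) ->
  (forall c i j, f [:: (c, j, i)] = - f [:: (c, i, j)]) -> adm f.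
Proof.
move=> f2 fd fa.
have z u v w1 e1 e2 : f (u ++ (w1 ++ [:: e1, e2 & v])) = 0.
  by case: u => [|? []]; case: w1 => [|? []] *; apply: f2.
split=> [u v e1 e2|r hr u v]; first by rewrite !(z u _ [::]) scaler0.
have fz u' v' w : (1 < size w)%N -> f (u' ++ w ++ v') = 0.
  by case: w => [|? [|? ?]] // _; rewrite (z _ _ [::]).
have [c i|c i j _|i j _|i j k _|i j k _|c i0 i1 s _|c i j k l _] := hr;
  rewrite ?big_cons ?big_nil.
- rewrite addr0; case: u v => [|? u] [|? v] /=; [exact: fd|exact: f2|..];
    by case: u => [|? u]; apply: f2.
- rewrite addr0; case: u v => [|? u] [|? v] /=; [by rewrite fa addNr|by rewrite !f2 addr0|..];
    by case: u => [|? u]; rewrite !f2 addr0.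
- by rewrite fz ?addr0.
- by rewrite !fz ?addr0.
- by rewrite !fz ?addr0.
- by rewrite fz ?addr0 //; case: s.
- by rewrite !fz ?addr0.
Qed.

Lemma adm0 : adm (fun _ : word I => 0 : V).
Proof. by split=> [*|*]; rewrite ?scaler0 // big1. Qed.

Lemma adm_comb k f g : adm f -> adm g -> adm (fun w => k *: f w + g w).
Proof.
move=> fa ga; split=> [u v e1 e2|r hr u v].
  by rewrite (adm_comm fa) (adm_comm ga) scalerDr !scalerA mulrC.
by rewrite big_split /= -scaler_sumr (adm_rel fa hr) (adm_rel ga hr) scaler0 addr0.
Qed.

End AdmClosure.

(** * Closed walks *)

Section ClosedWalks.
Context {K : fieldType} {I : FiniteSet} {V : lmodType K} (f : word I -> V).
Hypothesis fa : adm f.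
Implicit Types (x y : I) (p : seq (ab * I)).

Definition is_ga (e : ab * I) : bool := if e.1 is ga then true else false.

Lemma no_ga_bpath p : ~~ has is_ga p -> p = bpath (unzip2 p).
Proof. by elim: p => //= -[[] y] p IH //= /IH {1}->. Qed.

Lemma unzip2_bpath s : unzip2 (bpath s) = s :> seq I.
Proof. by elim: s => //= x s ->. Qed.

Lemma count_ga_bpath (s : seq I) : count is_ga (bpath s) = 0%N.
Proof. by elim: s. Qed.

(** The distinguished step is the one carrying [ga] if there is one, and the last step otherwise;
    rotating a closed walk will bring it to the front. *)
Lemma split_ga p : (0 < size p)%N -> (count is_ga p <= 1)%N ->
  exists p1 c y p2, [/\ p = p1 ++ (c, y) :: p2, ~~ has is_ga p1 & ~~ has is_ga p2].
Proof.
elim: p => //= -[[] y] p IH _ /=; rewrite ?add0n ?add1n ?ltnS ?leqn0 => hc.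
  by exists [::], ga, y, p; split=> //; rewrite has_count lt0n negbK.
case: p IH hc => [_ _|e p IH hc]; first by exists [::], gb, y, [::].
have [//|//|p1 [c [z [p2 [-> h1 h2]]]]] := IH.
by exists ((gb, y) :: p1), c, z, p2.
Qed.

Lemma split_mem y p : y \in unzip2 p -> exists p1 c p2, p = p1 ++ (c, y) :: p2.
Proof.
elim: p => //= -[c z] p IH; rewrite inE => /predU1P[->|/IH[p1 [d [p2 ->]]]].
  by exists [::], c, p.
by exists ((c, z) :: p1), d, p2.
Qed.

Lemma split_dup p : ~~ uniq (unzip2 p) ->
  exists p1 c y p2 d p3, p = p1 ++ (c, y) :: p2 ++ (d, y) :: p3.
Proof.
elim: p => //= -[c y] p IH; rewrite negb_and negbK => /orP[/split_mem[p2 [d [p3 ->]]]|].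
  by exists [::], c, y, p2, d, p3.
by move=> /IH[p1 [c' [y' [p2 [d [p3 ->]]]]]]; exists ((c, y) :: p1), c', y', p2, d, p3.
Qed.

(** A repeated vertex cuts out a shorter closed walk; if there is none, rotating the walk
    so as to start with its letter [a] turns it into a defining relation. *)
Lemma adm_closed_walk x p u v : (0 < size p)%N -> last x (unzip2 p) = x ->
  (count is_ga p <= 1)%N -> f (u ++ walk x p ++ v) = 0.
Proof.
have [n] := ubnP (size p); elim: n => // n IH in p x u v *.
rewrite ltnS => pn p0 px pc; case: (boolP (uniq (unzip2 p))) => [up|].
  have [p1 [c [y [p2 [E h1 h2]]]]] := split_ga p0 pc.
  move: px up; rewrite {p pn p0 pc}E /unzip2 map_cat last_cat uniq_catC /= => px up.
  set z := last x (unzip2 p1) in px *.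
  rewrite walk_cat -catA (adm_comm_cat _ _ _ _ fa) -/z.
  have -> : walk z ((c, y) :: p2) ++ walk x p1 ++ v = walk z ((c, y) :: (p2 ++ p1)) ++ v.
    by rewrite -cat_cons walk_cat /= px -catA.
  have hq : p2 ++ p1 = bpath (unzip2 (p2 ++ p1)).
    by apply: no_ga_bpath; rewrite has_cat negb_or h2.
  have lq : last y (unzip2 (p2 ++ p1)) = z by rewrite /unzip2 map_cat last_cat px.
  have {}up : uniq (y :: unzip2 (p2 ++ p1)) by rewrite /unzip2 map_cat.
  rewrite hq; move: (unzip2 _) lq up => q {hq}.
  (* A closed walk of one step is a loop, covered by [rel_diag] rather than by the cycle
     relations. *)
  case/lastP: q => [|q z'] /=; first by move=> -> _; rewrite adm_diag ?scaler0.
  rewrite last_rcons => ->; rewrite mem_rcons inE negb_or rcons_uniq -andbA.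
  case/and4P=> yz yq zq uq.
  have H : uniq [:: z, y & q] by rewrite /= inE negb_or eq_sym yz zq yq uq.
  have := adm_rel fa (rel_cycle c H) u v; rewrite big_seq1 /= => ->.
  by rewrite scaler0.
move=> /split_dup[p1 [c [y [p2 [d [p3 E]]]]]]; rewrite E.
(* The part between two visits of [y] is a closed walk, shorter because the step [(c, y)] is left
   out; the rest becomes context. *)
have -> : p1 ++ (c, y) :: p2 ++ (d, y) :: p3 = rcons p1 (c, y) ++ rcons p2 (d, y) ++ p3.
  by rewrite !cat_rcons.
rewrite !walk_cat -!catA catA /unzip2 map_rcons last_rcons; apply: IH.
- by apply: leq_trans pn; rewrite E !size_cat /= !size_cat size_rcons /=; lia.
- by rewrite size_rcons.
- by rewrite /unzip2 map_rcons last_rcons.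
- by move: pc; rewrite E -cats1 !count_cat /= !count_cat /=; lia.
Qed.

End ClosedWalks.

(** * Composition of functions on words *)

Section Unshuffle.
Context {I J : FiniteSet}.

Definition collapse (x : I + J) : option I := if x is inl i then Some i else None.

Definition outer (e : edge (I + J)%type) : option (edge (option I)) :=
  match e with
  | (_, inr _, inr _) => None
  | (c, x, y) => Some (c, collapse x, collapse y)
  end.

Definition inner (e : edge (I + J)%type) : option (edge J) :=
  if e is (c, inr i, inr j) then Some (c, i, j) else None.

Definition outw : word (I + J)%type -> word (option I) := pmap outer.
Definition inw : word (I + J)%type -> word J := pmap inner.

(** The parity of the unshuffling of [w] into [outw w] followed by [inw w]. *)
Fixpoint eps (w : word (I + J)%type) : bool :=
  if w is e :: w' then
    eps w' (+) (if inner e is Some e' then eodd e' && wodd (outw w') else false)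
  else false.

Lemma outw_cat u v : outw (u ++ v) = outw u ++ outw v.
Proof. exact: pmap_cat. Qed.

Lemma inw_cat u v : inw (u ++ v) = inw u ++ inw v.
Proof. exact: pmap_cat. Qed.

(** The cross term comes from the inner letters of [u] passing the outer letters of [v]. *)
Lemma eps_cat u v : eps (u ++ v) = eps u (+) eps v (+) (wodd (inw u) && wodd (outw v)).
Proof.
elim: u => [|e u IH]; first by rewrite addbF.
rewrite /= {}IH outw_cat wodd_cat.
have H a b c d k t : a (+) b (+) (c && d) (+) (k && (t (+) d)) =
    a (+) (k && t) (+) b (+) ((k (+) c) && d) by case: a b c d k t => [] [] [] [] [] [].
by case: e => [[t [i|i]] [j|j]]; rewrite /= ?addbF // H.
Qed.

Lemma wodd_unshuffle w : wodd w = wodd (outw w) (+) wodd (inw w).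
Proof.
by elim: w => //= -[[c [i|i]] [j|j]] w -> /=; first [exact: addbA|exact: addbCA].
Qed.

Lemma wdeg_unshuffle w : wdeg w = wdeg (outw w) + wdeg (inw w).
Proof.
elim: w => [|[[c [i|i]] [j|j]] w IH]; first by rewrite /wdeg !big_nil addr0.
1-3: by rewrite wdeg_cons IH /= wdeg_cons /= addrA.
by rewrite wdeg_cons IH /= wdeg_cons /= addrCA.
Qed.

(** The deleted steps run inside [J], that is from [None] to [None] after collapsing, so the
    remaining ones still form a walk. *)
Lemma outw_walk x p : exists2 q, outw (walk x p) = walk (collapse x) q &
  last (collapse x) (unzip2 q) = collapse (last x (unzip2 p)) /\
  (count is_ga q <= count is_ga p)%N.
Proof.
elim: p x => [|[c y] p IH] x; first by exists [::].
have [q E [hl hc]] := IH y.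
case: x y E hl => [i|i] [j|j] /= E hl; last first.
  by exists q => //; split=> //; exact: leq_trans hc (leq_addl _ _).
- by exists ((c, Some j) :: q); rewrite /= ?E //; split=> //; rewrite leq_add2l.
- by exists ((c, None) :: q); rewrite /= ?E //; split=> //; rewrite leq_add2l.
- by exists ((c, Some j) :: q); rewrite /= ?E //; split=> //; rewrite leq_add2l.
Qed.

(** With nothing outside, the walk never leaves [J]; this is the remaining case for closed walks,
    where the inner function takes over. *)
Lemma inw_walk x p : outw (walk x p) = [::] -> (0 < size p)%N ->
  exists2 y, x = inr y & exists2 q, inw (walk x p) = walk y q &
    last x (unzip2 p) = inr (last y (unzip2 q)) /\
    (count is_ga q <= count is_ga p)%N /\ size q = size p.
Proof.
elim: p x => // -[c y] p IH [i|i]; first by case: y.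
case: y => //= j E _; exists i => //.
case: p IH E => [|e p] IH E; first by exists [:: (c, j)] => //=; split=> //; case: c.
have [//|//|_ [<-] [q Eq [h1 [h2 h3]]]] := IH (inr j).
exists ((c, j) :: q); first by rewrite /= -Eq.
by split=> [//|]; split; [exact: leq_add (leqnn _) h2|rewrite /= h3].
Qed.

Variant edge_spec (e : edge (I + J)%type) :
    option (edge (option I)) -> option (edge J) -> Prop :=
| OuterEdge o of eodd o = eodd e : edge_spec e (Some o) None
| InnerEdge i of eodd i = eodd e : edge_spec e None (Some i).

Lemma edgeP e : edge_spec e (outer e) (inner e).
Proof. by case: e => [[c [i|i]] [j|j]]; constructor. Qed.

End Unshuffle.

Section Comp.
Context {K : fieldType} {I J : FiniteSet}.
Implicit Types (f : word (option I) -> K^o) (g : word J -> K^o).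

Definition wcomp f g (w : word (I + J)%type) : K^o :=
  (-1) ^+ eps w * (f (outw w) * g (inw w)).

(** The letters around [w] only twist [f] and [g] by signs, so that relations need only be
    checked without context. *)
Lemma wcomp_ctx f g u v :
  exists f' g' (k : K), [/\ adm f -> adm f', adm g -> adm g' &
    forall w, wcomp f g (u ++ w ++ v) = k * wcomp f' g' w].
Proof.
(* The first function records the inner letters of [u] passing the outer letters of [w], the second
   the inner letters of [w] passing the outer letters of [v], the scalar all that does not involve
   [w]. *)
exists (fun w => (-1) ^+ (wodd (inw u) && wodd w) *: f (outw u ++ w ++ outw v)).
exists (fun w => (-1) ^+ (wodd (outw v) && wodd w) *: g (inw u ++ w ++ inw v)).
exists ((-1) ^+ (eps u (+) eps v (+) (wodd (inw u) && wodd (outw v)))).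
split=> [fa|ga|w]; [exact: adm_ctx|exact: adm_ctx|].
rewrite /wcomp !outw_cat !inw_cat !eps_cat outw_cat wodd_cat /GRing.scale /=.
rewrite [wodd (inw w) && _]andbC andb_addr !signr_addb; ring.
Qed.

Section Local.
Variables (f : word (option I) -> K^o) (g : word J -> K^o).
Hypotheses (fa : adm f) (ga : adm g).
Notation F := (wcomp f g).

Lemma wcomp_comm2 e1 e2 : F [:: e1; e2] = (-1) ^+ (eodd e1 && eodd e2) * F [:: e2; e1].
Proof.
have cf e e' := adm_comm fa [::] [::] e e'; have cg e e' := adm_comm ga [::] [::] e e'.
rewrite /= in cf cg.
rewrite /wcomp /=; case: (edgeP e1) => /= [o1|i1] <-; case: (edgeP e2) => /= [o2|i2] <- /=.
- by rewrite cf /GRing.scale /=; ring.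
- by rewrite [RHS]mulrA -signr_addb; case: (eodd o1) (eodd i2) => [] [].
- by rewrite [RHS]mulrA -signr_addb; case: (eodd o2) (eodd i1) => [] [].
- by rewrite !andbF /= cg /GRing.scale /=; ring.
Qed.

Lemma wcomp_anti1 c x y : F [:: (c, y, x)] = - F [:: (c, x, y)].
Proof.
have af i j := adm_anti c i j [::] [::] fa; have ag i j := adm_anti c i j [::] [::] ga.
rewrite /= in af ag.
rewrite /wcomp; case: x y => [i|i] [j|j] /=; rewrite ?andbF /= expr0 !mul1r.
- by rewrite af mulNr.
- by rewrite af mulNr.
- by rewrite af mulNr.
- by rewrite ag mulrN.
Qed.

Lemma wcomp_walk x p : (0 < size p)%N -> last x (unzip2 p) = x ->
  (count is_ga p <= 1)%N -> F (walk x p) = 0.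
Proof.
move=> p0 px pc; rewrite /wcomp.
have [q E [h1 h2]] := outw_walk x p.
case: q E h1 h2 => [|e q] E h1 h2; last first.
  have := adm_closed_walk fa [::] [::] (x := collapse x) (p := e :: q) isT.
  rewrite cats0 cat0s -E => ->.
  - by rewrite mul0r mulr0.
  - by rewrite h1 px.
  - exact: leq_trans h2 pc.
have [y Ex [q Eq [h3 [h4 h5]]]] := inw_walk E p0.
have := adm_closed_walk ga [::] [::] (x := y) (p := q); rewrite cats0 cat0s -Eq => ->.
- by rewrite !mulr0.
- by rewrite h5.
- by move: h3; rewrite px Ex => -[].
- exact: leq_trans h4 pc.
Qed.

End Local.
End Comp.

(** * Relations among few letters, without context *)

Lemma uniq3P (T : eqType) (x y z : T) :
  uniq [:: x; y; z] <-> [/\ x <> y, x <> z & y <> z].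
Proof.
rewrite /= !inE !negb_or !andbT; split=> [/andP[/andP[] /eqP ? /eqP ?] /eqP ?|[]] //.
by do 3!move=> /eqP ->.
Qed.

Lemma uniq4P (T : eqType) (x y z t : T) :
  uniq [:: x; y; z; t] <-> [/\ x <> y, x <> z & x <> t] /\ [/\ y <> z, y <> t & z <> t].
Proof.
rewrite /= !inE !negb_or !andbT; split=> [|[[]]].
  by case/and3P=> /and3P[/eqP ? /eqP ? /eqP ?] /andP[/eqP ? /eqP ?] /eqP ?.
by do 3!move=> /eqP ->; case; do 3!move=> /eqP ->.
Qed.

Section LocalRelations.
Context {K : fieldType} {I : FiniteSet} (f : word I -> K^o).
Hypothesis fa : adm f.

Lemma adm_aa u v i j : f (u ++ [:: (ga, i, j), (ga, i, j) & v]) = 0.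
Proof.
have [<-|ij] := eqVneq i j; first exact: adm_diag.
by have := adm_rel fa (rel_aa ij) u v; rewrite big_seq1.
Qed.

Lemma adm_arnold i j k : i <> j -> i <> k -> j <> k ->
  f [:: (ga, i, j); (ga, j, k)] + f [:: (ga, j, k); (ga, k, i)] +
  f [:: (ga, k, i); (ga, i, j)] = 0.
Proof.
move=> ij ik jk; rewrite -(adm_rel fa (rel_arnold ((uniq3P i j k).2 (And3 ij ik jk))) [::] [::]).
by rewrite !big_cons big_nil addr0 addrA.
Qed.

Lemma adm_mixed i j k : i <> j -> i <> k -> j <> k ->
  f [:: (gb, i, j); (ga, j, k)] + f [:: (gb, j, k); (ga, k, i)] +
  f [:: (gb, k, i); (ga, i, j)] + f [:: (ga, i, j); (gb, j, k)] +
  f [:: (ga, j, k); (gb, k, i)] + f [:: (ga, k, i); (gb, i, j)] = 0.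
Proof.
move=> ij ik jk; rewrite -(adm_rel fa (rel_mixed ((uniq3P i j k).2 (And3 ij ik jk))) [::] [::]).
by rewrite !big_cons big_nil addr0 !addrA.
Qed.

Lemma adm_loop_aa i j : f [:: (ga, i, j); (ga, j, i)] = 0.
Proof. by rewrite (adm_anti ga i j [:: (ga, i, j)] [::] fa) (adm_aa [::] [::]) oppr0. Qed.

Lemma adm_loop_cb c i j v : f [:: (c, i, j), (gb, j, i) & v] = 0.
Proof.
have := adm_closed_walk fa [::] v (x := i) (p := [:: (c, j); (gb, i)]) isT erefl.
by move=> -> //; case: c.
Qed.

Lemma adm_loop_bc c i j v : f [:: (gb, i, j), (c, j, i) & v] = 0.
Proof.
have := adm_closed_walk fa [::] v (x := i) (p := [:: (gb, j); (c, i)]) isT erefl.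
by move=> -> //; case: c.
Qed.

Lemma adm_loop_bc' c i j e : f [:: e; (gb, i, j); (c, j, i)] = 0.
Proof.
have := adm_closed_walk fa [:: e] [::] (x := i) (p := [:: (gb, j); (c, i)]) isT erefl.
by move=> -> //; case: c.
Qed.

Lemma adm_loop_cb' c i j e : f [:: e; (c, i, j); (gb, j, i)] = 0.
Proof.
have := adm_closed_walk fa [:: e] [::] (x := i) (p := [:: (c, j); (gb, i)]) isT erefl.
by move=> -> //; case: c.
Qed.

Lemma adm_loop3 c i j k : f [:: (gb, i, j); (c, j, k); (gb, k, i)] = 0.
Proof.
have := adm_closed_walk fa [::] [::] (x := i) (p := [:: (gb, j); (c, k); (gb, i)]) isT erefl.
by move=> -> //; case: c.
Qed.

(** For [c = a] this is the mixed relation, for [c = b] the terms cancel in pairs. *)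
Lemma adm_six c i j k : i <> j -> i <> k -> j <> k ->
  f [:: (gb, i, j); (c, j, k)] + f [:: (gb, i, k); (c, k, j)] +
  f [:: (gb, j, i); (c, i, k)] + f [:: (gb, j, k); (c, k, i)] +
  f [:: (gb, k, i); (c, i, j)] + f [:: (gb, k, j); (c, j, i)] = 0.
Proof.
move=> ij ik jk.
have h x y z : f [:: (gb, x, y); (c, y, z)] = (-1) ^+ eodd (c, y, z) * f [:: (c, z, y); (gb, y, x)].
  rewrite (adm_comm fa [::] [::]) /= (adm_anti c z y [::] _ fa) /=.
  by rewrite (adm_anti gb y x [:: _] [::] fa) opprK.
rewrite (h i k j) (h j i k) (h k j i); case: c h => h.
  by rewrite !mul1r -[RHS](adm_mixed ij ik jk); ring.
by rewrite (h j k i) (h k i j) (h i j k) /= expr1; ring.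
Qed.

End LocalRelations.

Definition path_sum {K : fieldType} {I : FiniteSet} (F : word I -> K^o) c (i j k l : I) : K :=
  \sum_(w <- words4 i j k l) F (path4 c w).

(** * Symmetry of the twelve-word sums *)

Section PathSum.
Context {K : fieldType} {I : FiniteSet} (F : word I -> K^o).
Hypothesis Fcomm : forall u v e1 e2,
  F (u ++ e1 :: e2 :: v) = (-1) ^+ (eodd e1 && eodd e2) *: F (u ++ e2 :: e1 :: v).
Hypothesis Fanti : forall c i j u v, F (u ++ (c, j, i) :: v) = - F (u ++ (c, i, j) :: v).

(** Reversal costs three antisymmetry signs and the Koszul sign of reversing b, c, b, which is -1
    for either [c]; the total is 1. The twelve words thus represent the 24 orderings of the indices
    up to reversal, which is why their sum is symmetric. *)
Lemma path4_rev c x y z t : F (path4 c (x, y, z, t)) = F (path4 c (t, z, y, x)).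
Proof.
rewrite /path4 (Fanti gb y x [::]) (Fanti c z y [:: (gb, y, x)])
  (Fanti gb t z [:: (gb, y, x); (c, z, y)] [::]) /=.
rewrite (Fcomm [::]) (Fcomm [:: (c, z, y)] [::]) (Fcomm [::] [:: (gb, y, x)]) /GRing.scale /=.
by case: c => /=; rewrite ?expr0 ?expr1 ?mul1r !(mulN1r, mulrN, opprK).
Qed.

(** The exchange permutes the list of words, once two of them are reversed. *)
Lemma path_sum12 c i j k l : path_sum F c i j k l = path_sum F c j i k l.
Proof.
rewrite /path_sum !big_cons !big_nil (path4_rev c j k l i) (path4_rev c j l k i).
ring.
Qed.

Lemma path_sum23 c i j k l : path_sum F c i j k l = path_sum F c i k j l.
Proof.
rewrite /path_sum !big_cons !big_nil (path4_rev c k i l j) (path4_rev c k l i j); ring.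
Qed.

Lemma path_sum34 c i j k l : path_sum F c i j k l = path_sum F c i j l k.
Proof.
rewrite /path_sum !big_cons !big_nil (path4_rev c l i j k) (path4_rev c l j i k); ring.
Qed.

End PathSum.

(** * The relations for a composite, by distribution of the indices *)

Section Local.
Context {K : fieldType} {I J : FiniteSet}.
Variables (f : word (option I) -> K^o) (g : word J -> K^o).
Hypotheses (fA : adm f) (gA : adm g).
Notation F := (wcomp f g).

Let fanti c i j : f [:: (c, j, i)] = - f [:: (c, i, j)].
Proof. exact: (adm_anti c i j [::] [::] fA). Qed.

Let ganti c i j : g [:: (c, j, i)] = - g [:: (c, i, j)].
Proof. exact: (adm_anti c i j [::] [::] gA). Qed.

(** With two indices in [J], one term is an outer loop and the other two cancel by antisymmetry;
    otherwise the relation is inherited from [f] or from [g]. *)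
Lemma wcomp_arnold (i j k : (I + J)%type) : i <> j -> i <> k -> j <> k ->
  F [:: (ga, i, j); (ga, j, k)] + F [:: (ga, j, k); (ga, k, i)] +
  F [:: (ga, k, i); (ga, i, j)] = 0.
Proof.
case: i j k => [i|i] [j|j] [k|k] ij ik jk; rewrite /wcomp /= ?expr0 ?mul1r.
1-3,5: by rewrite -!mulrDl adm_arnold ?mul0r //; congruence.
- by rewrite (fanti ga None (Some i)) adm_loop_aa //; ring.
- by rewrite (fanti ga None (Some j)) adm_loop_aa //; ring.
- by rewrite (fanti ga None (Some k)) adm_loop_aa //; ring.
- by rewrite -!mulrDr adm_arnold ?mulr0 //; congruence.
Qed.

Lemma wcomp_mixed (i j k : (I + J)%type) : i <> j -> i <> k -> j <> k ->
  F [:: (gb, i, j); (ga, j, k)] + F [:: (gb, j, k); (ga, k, i)] +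
  F [:: (gb, k, i); (ga, i, j)] + F [:: (ga, i, j); (gb, j, k)] +
  F [:: (ga, j, k); (gb, k, i)] + F [:: (ga, k, i); (gb, i, j)] = 0.
Proof.
case: i j k => [i|i] [j|j] [k|k] ij ik jk; rewrite /wcomp /= ?expr0 ?mul1r.
1-3,5: by rewrite -!mulrDl adm_mixed ?mul0r //; congruence.
- rewrite (fanti ga None (Some i)) (fanti gb None (Some i)) adm_loop_cb // adm_loop_bc //; ring.
- rewrite (fanti ga None (Some j)) (fanti gb None (Some j)) adm_loop_cb // adm_loop_bc //; ring.
- rewrite (fanti ga None (Some k)) (fanti gb None (Some k)) adm_loop_cb // adm_loop_bc //; ring.
- by rewrite -!mulrDr adm_mixed ?mulr0 //; congruence.
Qed.

Lemma wcomp_path0 c (i j k l : I) : i <> j -> i <> k -> i <> l -> j <> k -> j <> l -> k <> l ->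
  path_sum F c (inl i) (inl j) (inl k) (inl l) = 0.
Proof.
move=> ij ik il jk jl kl.
have H : uniq ([:: Some i; Some j; Some k; Some l] : seq (fs_option I)).
  by apply/uniq4P; split; split; congruence.
transitivity ((\sum_(w <- [seq path4 c w | w <- words4 (Some i) (Some j) (Some k) (Some l)])
   f ([::] ++ w ++ [::])) * g [::]); last first.
  by rewrite (adm_rel fA (@rel_path (fs_option I) c _ _ _ _ H)) mul0r.
by rewrite big_map /path_sum !big_cons !big_nil /wcomp /= ?expr0 ?mul1r ?mulrDl ?mul0r.
Qed.

(** The contracted point [None] takes the place of [i], so the relation for [f] applies. *)
Lemma wcomp_path1 c (i : J) (j k l : I) : j <> k -> j <> l -> k <> l ->
  path_sum F c (inr i) (inl j) (inl k) (inl l) = 0.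
Proof.
move=> jk jl kl.
have H : uniq ([:: None; Some j; Some k; Some l] : seq (fs_option I)).
  by apply/uniq4P; split; split; congruence.
transitivity ((\sum_(w <- [seq path4 c w | w <- words4 None (Some j) (Some k) (Some l)])
   f ([::] ++ w ++ [::])) * g [::]); last first.
  by rewrite (adm_rel fA (@rel_path (fs_option I) c _ _ _ _ H)) mul0r.
by rewrite big_map /path_sum !big_cons !big_nil /wcomp /= ?expr0 ?mul1r ?mulrDl ?mul0r.
Qed.

Lemma wcomp_path4 c (i j k l : J) : i <> j -> i <> k -> i <> l -> j <> k -> j <> l -> k <> l ->
  path_sum F c (inr i) (inr j) (inr k) (inr l) = 0.
Proof.
move=> ij ik il jk jl kl.
have H : uniq [:: i; j; k; l] by apply/uniq4P.
transitivity (f [::] * (\sum_(w <- [seq path4 c w | w <- words4 i j k l])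
   g ([::] ++ w ++ [::]))); last by rewrite (adm_rel gA (rel_path c H)) mulr0.
by rewrite big_map /path_sum !big_cons !big_nil /wcomp /= ?andbF ?expr0 ?mul1r ?mulrDr ?mulr0.
Qed.

(** Paths in which [i] and [j] are not adjacent contain a closed outer walk; the others cancel in
    pairs under the exchange of [i] and [j]. *)
Lemma wcomp_path2 c (i j : J) (k l : I) :
  path_sum F c (inr i) (inr j) (inl k) (inl l) = 0.
Proof.
rewrite /path_sum !big_cons !big_nil /wcomp /=.
rewrite !(adm_loop_bc fA) !(adm_loop3 fA) ?(adm_loop_cb' fA) ?(adm_loop_bc' fA).
by rewrite (ganti gb i j) (ganti c i j) /eodd /=; ring.
Qed.

(** If [l] is interior to the path, its two letters form a closed outer walk. If it is the endpoint,
    the outer word is the single letter from [None] to [l], and the six inner words add up to zero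
    by [adm_six]. *)
Lemma wcomp_path3 c (i j k : J) (l : I) : i <> j -> i <> k -> j <> k ->
  path_sum F c (inr i) (inr j) (inr k) (inl l) = 0.
Proof.
move=> ij ik jk.
rewrite /path_sum !big_cons !big_nil /wcomp /=.
rewrite ?(adm_loop_bc fA) ?(adm_loop_cb fA).
have S := adm_six gA c ij ik jk.
(* The common sign moves the odd outer letter in front of the two inner ones. *)
transitivity ((-1) ^+ (eodd (c, i, j) && true (+) true) * f [:: (gb, None, Some l)] *
  (g [:: (gb, i, j); (c, j, k)] + g [:: (gb, i, k); (c, k, j)] +
   g [:: (gb, j, i); (c, i, k)] + g [:: (gb, j, k); (c, k, i)] +
   g [:: (gb, k, i); (c, i, j)] + g [:: (gb, k, j); (c, j, i)])).
  by rewrite /eodd /=; ring.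
by rewrite S mulr0.
Qed.

Lemma wcomp_diag u v c x : F (u ++ (c, x, x) :: v) = 0.
Proof.
have [f' [g' [k [/(_ fA) f'A /(_ gA) g'A E]]]] := wcomp_ctx f g u v.
rewrite -cat1s E (@wcomp_walk _ _ _ _ _ f'A g'A x [:: (c, x)]) ?mulr0 //.
by case: c {E}.
Qed.

Lemma wcomp_anti c x y u v : F (u ++ (c, y, x) :: v) = - F (u ++ (c, x, y) :: v).
Proof.
have [f' [g' [k [/(_ fA) f'A /(_ gA) g'A E]]]] := wcomp_ctx f g u v.
by rewrite -![_ :: v]cat1s !E (wcomp_anti1 f'A g'A) mulrN.
Qed.

Lemma wcomp_comm u v e1 e2 :
  F (u ++ e1 :: e2 :: v) = (-1) ^+ (eodd e1 && eodd e2) *: F (u ++ e2 :: e1 :: v).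
Proof.
have [f' [g' [k [/(_ fA) f'A /(_ gA) g'A E]]]] := wcomp_ctx f g u v.
rewrite -[LHS]/(F (u ++ [:: e1; e2] ++ v)) -[F (u ++ [:: e2, e1 & v])]/(F (u ++ [:: e2; e1] ++ v)).
by rewrite !E (wcomp_comm2 f'A g'A) /GRing.scale /= mulrCA.
Qed.

Lemma wcomp_path c (i j k l : (I + J)%type) :
  i <> j -> i <> k -> i <> l -> j <> k -> j <> l -> k <> l ->
  path_sum F c i j k l = 0.
Proof.
have s12 := path_sum12 wcomp_comm wcomp_anti; have s23 := path_sum23 wcomp_comm wcomp_anti.
have s34 := path_sum34 wcomp_comm wcomp_anti.
case: i j k l => [i|i] [j|j] [k|k] [l|l] ij ik il jk jl kl.
- by apply: wcomp_path0; congruence.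
- by rewrite s34 s23 s12; apply: wcomp_path1; congruence.
- by rewrite s23 s12; apply: wcomp_path1; congruence.
- by rewrite s23 s12 s34 s23; apply: wcomp_path2; congruence.
- by rewrite s12; apply: wcomp_path1; congruence.
- by rewrite s12 s34 s23; apply: wcomp_path2; congruence.
- by rewrite s12 s23; apply: wcomp_path2; congruence.
- by rewrite s12 s23 s34; apply: wcomp_path3; congruence.
- by apply: wcomp_path1; congruence.
- by rewrite s34 s23; apply: wcomp_path2; congruence.
- by rewrite s23; apply: wcomp_path2; congruence.
- by rewrite s23 s34; apply: wcomp_path3; congruence.
- by apply: wcomp_path2; congruence.
- by rewrite s34; apply: wcomp_path3; congruence.
- by apply: wcomp_path3; congruence.
- by apply: wcomp_path4; congruence.
Qed.

End Local.

Section AdmComp.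
Context {K : fieldType} {I J : FiniteSet}.
Variables (f : word (option I) -> K^o) (g : word J -> K^o).
Hypotheses (fA : adm f) (gA : adm g).

Lemma adm_wcomp : adm (wcomp f g).
Proof.
split=> [u v e1 e2|r hr u v]; first exact: wcomp_comm.
have [f' [g' [k [/(_ fA) f'A /(_ gA) g'A E]]]] := wcomp_ctx f g u v.
under eq_bigr do rewrite E.
rewrite -mulr_sumr; apply/eqP; rewrite mulf_eq0; apply/orP; right; apply/eqP => {E k}.
case: hr => {r} [c i|c i j _|i j _|i j k h|i j k h|c i0 i1 s _|c i j k l h].
- by rewrite big_seq1 -[_ [:: _]]/(_ ([::] ++ [:: _])) wcomp_diag.
- by rewrite big_cons big_seq1 (wcomp_anti1 f'A g'A) addNr.
- rewrite big_seq1 /wcomp; case: i j => [i|i] [j|j] /=.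
  + by rewrite (adm_aa f'A [::] [::]) mul0r mulr0.
  + by rewrite (adm_aa f'A [::] [::]) mul0r mulr0.
  + by rewrite (adm_aa f'A [::] [::]) mul0r mulr0.
  + by rewrite (adm_aa g'A [::] [::]) !mulr0.
- by have /uniq3P[ij ik jk] := h; rewrite !big_cons big_nil addr0 addrA wcomp_arnold.
- by have /uniq3P[ij ik jk] := h; rewrite !big_cons big_nil addr0 !addrA wcomp_mixed.
- rewrite big_seq1; apply: wcomp_walk => //=.
    by rewrite unzip2_bpath last_rcons.
  by rewrite count_ga_bpath; case: c.
- by have /uniq4P[[ij ik il] [jk jl kl]] := h; rewrite big_map;
    exact: (wcomp_path f'A g'A c ij ik il jk jl kl).
Qed.

End AdmComp.

(** * Formal composites as functions on words *)

Definition emap (I J : FiniteSet) (h : I -> J) (e : edge I) : edge J :=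
  (e.1.1, h e.1.2, h e.2).
Definition wmap (I J : FiniteSet) (h : I -> J) : word I -> word J := map (emap h).

Section Relabel.
Context {I J : FiniteSet}.
Variable h : I -> J.

Lemma wodd_wmap w : wodd (wmap h w) = wodd w.
Proof. by elim: w => //= e w ->. Qed.

Lemma wdeg_wmap w : wdeg (wmap h w) = wdeg w.
Proof. by rewrite /wdeg big_map. Qed.

Lemma wmap_walk x p : wmap h (walk x p) = walk (h x) [seq (e.1, h e.2) | e <- p].
Proof. by elim: p x => //= -[c y] p IH x /=; rewrite IH. Qed.

Lemma Rrel_wmap r : injective h -> Rrel r -> Rrel (map (wmap h) r).
Proof.
move=> hi; case=> {r} [c i|c i j ij|i j ij|i j k H|i j k H|c i0 i1 s H|c i j k l H].
- exact: rel_diag.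
- by apply: rel_anti; rewrite (inj_eq hi).
- by apply: rel_aa; rewrite (inj_eq hi).
- by apply: rel_arnold; rewrite -(map_inj_uniq hi) in H.
- by apply: rel_mixed; rewrite -(map_inj_uniq hi) in H.
- rewrite -(map_inj_uniq hi) in H.
  have -> : map (wmap h) [:: walk i0 ((c, i1) :: bpath (rcons s i0))] =
      [:: walk (h i0) ((c, h i1) :: bpath (rcons (map h s) (h i0)))].
    by rewrite /= wmap_walk -map_rcons /bpath -!map_comp.
  exact: rel_cycle.
- by rewrite -(map_inj_uniq hi) in H; apply: (rel_path c H).
Qed.

Lemma adm_wmap (K : fieldType) (V : lmodType K) (f : word J -> V) :
  injective h -> adm f -> adm (f \o wmap h).
Proof.
move=> hi fA; split=> [u v e1 e2|r hr u v] /=.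
  by rewrite /wmap !map_cat /= (adm_comm fA).
have := adm_rel fA (Rrel_wmap hi hr) (wmap h u) (wmap h v); rewrite big_map => E; rewrite -[RHS]E.
by apply: eq_bigr => w _; rewrite /wmap !map_cat.
Qed.

End Relabel.

Lemma eq_wmap (I J : FiniteSet) (h h' : I -> J) : h =1 h' -> wmap h =1 wmap h'.
Proof. by move=> E; apply: eq_map => e; rewrite /emap !E. Qed.

Lemma wmap_comp (I J L : FiniteSet) (h : J -> L) (h' : I -> J) w :
  wmap h (wmap h' w) = wmap (h \o h') w.
Proof. by rewrite /wmap -map_comp. Qed.

Lemma wmap_id (I : FiniteSet) (w : word I) : wmap id w = w.
Proof. by elim: w => //= -[[c i] j] w ->. Qed.

Section RamWords.
Context {K : fieldType}.

(** [y%:R - x%:R] is [1] on [(false, true)], [-1] on [(true, false)] and [0] on loops. *)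
Definition gen_word (g : ram_gen) (w : word bool) : K^o :=
  match g, w with
  | gE, [::] => 1
  | gL, [:: (ga, x, y)] => y%:R - x%:R
  | gOmega, [:: (gb, x, y)] => y%:R - x%:R
  | _, _ => 0
  end.

(** The pairing of a formal composite with a word of [R(I)]. *)
Fixpoint pairing (I : FiniteSet) (M : ram_term K I) : word I -> K^o :=
  match M with
  | MZero _ => fun=> 0
  | MAdd _ x y => fun w => pairing x w + pairing y w
  | MScale _ k x => fun w => k * pairing x w
  | MMap _ _ s x => pairing x \o wmap (bij_inv s)
  | MId => fun w => (nilp w)%:R
  | MComp _ _ x y => wcomp (pairing x) (pairing y)
  | MGen g => gen_word g
  end.

Lemma adm_pairing I (M : ram_term K I) : adm (pairing M).
Proof.
elim: M => {I} [I|I x xA y yA|I k x xA|I J s x xA||I J x xA y yA|g] /=.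
- exact: adm0.
- have -> : (fun w => pairing x w + pairing y w) = (fun w => 1 *: pairing x w + pairing y w).
    by apply/funext => w; rewrite scale1r.
  exact: adm_comb.
- have -> : (fun w => k * pairing x w) = (fun w => k *: pairing x w + 0).
    by apply/funext => w; rewrite addr0.
  exact: (adm_comb k xA adm0).
- exact: (adm_wmap (can_inj (bij_invK s))).
- by apply: adm_of_short => *; rewrite /= ?oppr0.
- exact: adm_wcomp.
- apply: adm_of_short => [[[[] ?] ?] e2 w|c i|c i j]; case: g => //=.
  + by case: c; rewrite ?subrr.
  + by case: c; rewrite ?subrr.
  + by rewrite oppr0.
  + by case: c; rewrite ?opprB ?oppr0.
  + by case: c; rewrite ?opprB ?oppr0.
Qed.

Lemma pairing_hdeg I p (M : ram_term K I) w : ram_hdeg p M -> wdeg w <> p -> pairing M w = 0.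
Proof.
move=> h; elim: h w => {I p M}
  [//|I p x y _ IHx _ IHy|I p k x _ IH|I J p s x _ IH||I J p q x y _ IHx _ IHy|g] w /= hw.
- by rewrite IHx // IHy // addr0.
- by rewrite IH // mulr0.
- by apply: IH; rewrite wdeg_wmap.
- by case: w hw => // -[]; rewrite /wdeg big_nil.
- rewrite /wcomp; have [E|/eqP/IHx->] := eqVneq (wdeg (outw w)) p; last by rewrite mul0r mulr0.
  by rewrite IHy ?mulr0 // => E'; apply: hw; rewrite wdeg_unshuffle E E'.
- case: g w hw => [] [|[[[] ?] ?] [|? ?]] //=; rewrite /wdeg ?big_seq1 ?big_nil //.
Qed.

Lemma outw_bij_sum (I I' J J' : FiniteSet) (s : bij I I') (t : bij J J') w :
  outw (wmap (bij_inv (bij_sum s t)) w) = wmap (bij_inv (bij_option s)) (outw w).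
Proof. by elim: w => //= -[[c [i|i]] [j|j]] w /= ->. Qed.

Lemma inw_bij_sum (I I' J J' : FiniteSet) (s : bij I I') (t : bij J J') w :
  inw (wmap (bij_inv (bij_sum s t)) w) = wmap (bij_inv t) (inw w).
Proof. by elim: w => //= -[[c [i|i]] [j|j]] w /= ->. Qed.

Lemma eps_bij_sum (I I' J J' : FiniteSet) (s : bij I I') (t : bij J J') w :
  eps (wmap (bij_inv (bij_sum s t)) w) = eps w.
Proof.
by elim: w => //= -[[c [i|i]] [j|j]] w -> //=; rewrite outw_bij_sum wodd_wmap.
Qed.

(** Both iterated splittings produce the same three subwords, and the total unshuffling signs agree
    letter by letter. *)
Lemma wcomp_seq (I J L : FiniteSet) (f : word (option I) -> K^o) (g : word (option J) -> K^o)
    (h : word L -> K^o) w :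
  wcomp (wcomp f g \o wmap (bij_inv (bij_optr I J))) h w =
  wcomp f (wcomp g h) (wmap (bij_inv (bij_assoc I J L)) w).
Proof.
set w' := wmap _ w; set v := wmap (bij_inv (bij_optr I J)) (outw w).
have [E1 E2 E3 E4] : [/\ outw v = outw w', inw v = outw (inw w'), inw w = inw (inw w') &
    eps w (+) eps v = eps w' (+) eps (inw w')].
  rewrite {}/w' {}/v; elim: w => //= e w [E1 E2 E3 E4].
  case: e => [[c [[i|i]|i]] [[j|j]|j]] /=; rewrite ?E1 ?E2 ?E3 /=; split=> //;
    rewrite ?addbF ?E4 //.
  1-3: by rewrite addbA E4 addbAC.
  (* A letter inside [L] passes [outw w] at once on one side, and its two parts in succession on the
     other. *)
  have -> : wodd (outw w) = wodd (outw (wmap (bij_inv (bij_assoc I J L)) w)) (+)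
      wodd (outw (inw (wmap (bij_inv (bij_assoc I J L)) w))).
    by rewrite -E1 -E2 -wodd_unshuffle wodd_wmap.
  by rewrite andb_addr addbAC E4 addbACA.
rewrite /wcomp /= -/v -E1 -E2 -E3.
rewrite (_ : (-1) ^+ eps w = (-1) ^+ eps w' * (-1) ^+ eps (inw w') * (-1) ^+ eps v).
  by case: (eps v) => /=; ring.
by rewrite -signr_addb -E4 -signr_addb -addbA addbb addbF.
Qed.

(** The three subwords agree, but the two inner ones are extracted in opposite orders; the extra
    sign is that of exchanging them. *)
Lemma wcomp_par (I J L : FiniteSet) (f : word (option (option I)) -> K^o) (g : word J -> K^o)
    (h : word L -> K^o) w :
  let v := wmap (bij_inv (bij_sumAC I J L)) w in
  wcomp (wcomp f g \o wmap (bij_inv (bij_optl I J))) h w =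
  (-1) ^+ (wodd (inw v) && wodd (inw (wmap (bij_inv (bij_optl I L)) (outw v)))) *
    wcomp (wcomp (f \o wmap (bij_inv (bij_optC I))) h \o wmap (bij_inv (bij_optl I L))) g v.
Proof.
set w1 := wmap (bij_inv (bij_optl I J)) (outw w) => v.
set w2 := wmap (bij_inv (bij_optl I L)) (outw v).
have [E1 E2 E3 E4] : [/\ outw w1 = wmap (bij_inv (bij_optC I)) (outw w2),
    inw w1 = inw v, inw w = inw w2 &
    eps w (+) eps w1 = (wodd (inw v) && wodd (inw w2)) (+) (eps v (+) eps w2)].
  rewrite {}/w1 {}/w2 {}/v; elim: w => //= e w [E1 E2 E3 E4].
  set w1 := wmap (bij_inv (bij_optl I J)) (outw w) in E1 E2 E4.
  set v := wmap _ w in E1 E2 E3 E4.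
  set w2 := wmap _ (outw v) in E1 E3 E4.
  have O1 : wodd (outw v) = wodd (outw w2) (+) wodd (inw w2).
    by rewrite -wodd_unshuffle wodd_wmap.
  have O2 : wodd (outw w) = wodd (outw w2) (+) wodd (inw v).
    rewrite -(wodd_wmap (bij_inv (bij_optl I J))) -/w1 wodd_unshuffle E1 E2.
    by rewrite wodd_wmap.
  have bJ A B C D X Y Z o : A (+) B = (Y && Z) (+) (C (+) D) -> A (+) (B (+) (o && X)) =
      ((o (+) Y) && Z) (+) ((C (+) (o && (X (+) Z))) (+) D).
    by case: A B C D X Y Z o => [] [] [] [] [] [] [] [].
  have bL A B C D X Y Z o : A (+) B = (Y && Z) (+) (C (+) D) -> A (+) (o && (X (+) Y)) (+) B =
      (Y && (o (+) Z)) (+) (C (+) (D (+) (o && X))).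
    by case: A B C D X Y Z o => [] [] [] [] [] [] [] [].
  case: e => [[c [[i|i]|i]] [[j|j]|j]] /=; rewrite -/w1 -/v -/w2 ?E1 ?E2 ?E3 /= ?addbF;
    split=> //.
  - by rewrite wodd_wmap O1; apply: bJ.
  - by rewrite O2; apply: bL.
rewrite /wcomp /= -/w1 -/v -/w2 E1 E2 E3.
rewrite (_ : (-1) ^+ eps w = (-1) ^+ (wodd (inw v) && wodd (inw w2)) * (-1) ^+ eps v *
   (-1) ^+ eps w2 * (-1) ^+ eps w1); first by case: (eps w1) => /=; ring.
by rewrite -!signr_addb -[_ (+) _ (+) eps w2]addbA -E4 -addbA addbb addbF.
Qed.

Lemma pairing_map I J (s : bij I J) (M : ram_term K I) w :
  pairing (MMap s M) w = pairing M (wmap (bij_inv s) w).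
Proof. by []. Qed.

Lemma pairing_add I (M N : ram_term K I) w : pairing (MAdd M N) w = pairing M w + pairing N w.
Proof. by []. Qed.

(** Each generator vanishes on words of more than one letter, and the letters of [w] are shared
    between the two. *)
Lemma pairing_comp3_long g h w : (2 < size w)%N -> pairing (comp3 g h : ram_term K _) w = 0.
Proof.
have gen0 k u : (1 < size u)%N -> gen_word k u = 0.
  by case: k u => [] [|[[[] ?] ?] [|? ?]].
rewrite /= /wcomp /= => hw.
have hs : size w = (size (outw w) + size (inw w))%N.
  by elim: (w) => //= -[[c [i|i]] [j|j]] u ->; rewrite /= ?addnS.
have [h1|h1] := ltnP 1 (size (inw w)); first by rewrite (gen0 h) ?mulr0.
rewrite (gen0 g) ?mul0r ?mulr0 // size_map ltnNge; apply/negP => h2.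
by move: hw; rewrite hs ltnNge => /negP; apply; exact: leq_add h2 h1.
Qed.

(** On three points, loops and antisymmetry leave only the three cyclically oriented edges. *)
Lemma adm_letters (F : word (unit + bool)%type -> K^o) u v : adm F ->
  (forall c x, F (u ++ (c, x, bij_rot x) :: v) = 0) ->
  forall e, F (u ++ e :: v) = 0.
Proof.
move=> FA h [[c x] y].
have [->|[->|->]] : x = y \/ y = bij_rot x \/ x = bij_rot y.
- by case: x y => [[]|[]] [[]|[]] /=; tauto.
- exact: adm_diag.
- exact: h.
- by rewrite (adm_anti _ _ _ _ _ FA) h oppr0.
Qed.

(** The difference is the pairing of a formal difference, hence admissible; each relation of Ram in
    arity three becomes a finite table. *)
Lemma pairing_eq3 (M N : ram_term K (unit + bool)%type) :
  (forall w, (2 < size w)%N -> pairing M w = 0) -> (forall w, (2 < size w)%N -> pairing N w = 0) ->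
  pairing M [::] = pairing N [::] ->
  (forall c x, pairing M [:: (c, x, bij_rot x)] = pairing N [:: (c, x, bij_rot x)]) ->
  (forall c x d y, pairing M [:: (c, x, bij_rot x); (d, y, bij_rot y)] =
                   pairing N [:: (c, x, bij_rot x); (d, y, bij_rot y)]) ->
  pairing M =1 pairing N.
Proof.
move=> hM hN h0 h1 h2 w; apply/eqP; rewrite -subr_eq0; apply/eqP.
pose F := pairing (MAdd M (MScale (-1) N)).
have FE u : F u = pairing M u - pairing N u by rewrite /F /= mulN1r.
rewrite -FE; have FA : adm F by apply: adm_pairing.
case: w => [|e1 [|e2 [|e3 w]]].
- by rewrite FE h0 subrr.
- by apply: (adm_letters (u := [::]) FA) => c x; rewrite FE h1 subrr.
- apply: (adm_letters (u := [::]) FA) => c x; apply: (adm_letters (u := [:: _]) FA) => d y.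
  by rewrite FE h2 subrr.
- by rewrite FE hM // hN // subrr.
Qed.

(** Since [ram_eqv] is the least such congruence, the pairing descends to Ram. *)
Lemma pairing_ram_congr : ram_congr (fun I (x y : ram_term K I) => pairing x =1 pairing y).
Proof.
split.
- move=> I; split=> //=.
  + by move=> x y h w; rewrite h.
  + by move=> x y z h1 h2 w; rewrite h1.
  + by move=> x x' y y' h1 h2 w; rewrite h1 h2.
  + by move=> k x x' h w; rewrite h.
  + by move=> *; move=> w; rewrite addrA.
  + by move=> *; move=> w; rewrite addrC.
  + by move=> *; move=> w; rewrite add0r.
  + by move=> *; move=> w; rewrite mulN1r addNr.
  + by move=> *; move=> w; rewrite mulrA.
  + by move=> *; move=> w; rewrite mul1r.
  + by move=> *; move=> w; rewrite mulrDr.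
  + by move=> *; move=> w; rewrite mulrDl.
- by move=> I J s x x' h w /=; rewrite h.
- by [].
- by [].
- by move=> I x w /=; rewrite wmap_id.
- move=> I J L s t u x E w /=; rewrite wmap_comp; congr (pairing x _); apply: eq_wmap => l /=.
  by apply: (can_inj (bij_funK u)); rewrite bij_invK E /= !bij_invK.
- by move=> I J x x' y y' hx hy w; rewrite /= /wcomp hx hy.
- by move=> I J x x' y w; rewrite /= /wcomp; ring.
- by move=> I J x y y' w; rewrite /= /wcomp; ring.
- by move=> I J k x y w; rewrite /= /wcomp; ring.
- by move=> I J k x y w; rewrite /= /wcomp; ring.
- move=> I I' J J' s t x y w; rewrite [pairing _ w]/= [RHS]/= /wcomp /=.
  by rewrite outw_bij_sum inw_bij_sum eps_bij_sum.
- by move=> I J L x y z w; apply: wcomp_seq.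
- move=> I J L p q x y z hy hz w.
  rewrite [LHS]/= wcomp_par /=.
  rewrite /wcomp /=; set v := wmap _ w; set w2 := wmap _ (outw v).
  (* The sign in the axiom uses the degrees of [y] and [z]; by homogeneity these are the degrees of
     the words on which they do not vanish. *)
  have [<-|/(pairing_hdeg hy)->] := pselect (wdeg (inw v) = p); last by rewrite !mulr0.
  have [<-|/(pairing_hdeg hz)->] := pselect (wdeg (inw w2) = q); last by rewrite !(mul0r, mulr0).
  by rewrite koszul_wdeg.
- move=> J y w /=; rewrite /wcomp.
  have [-> -> ->] : [/\ eps (wmap inr w : word (void + J)%type) = false,
      outw (wmap inr w : word (void + J)%type) = [::] &
      inw (wmap inr w : word (void + J)%type) = w].
    by elim: w => //= -[[c i] j] w [-> -> ->]; rewrite andbF.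
  by rewrite !mul1r.
- move=> I x w; rewrite /= /wcomp; set w' := wmap _ w.
  (* Splitting undoes the relabelling unless some letter has both ends at [None]. Such a letter
     becomes an inner letter, killed by the unit, and on the other side it is a loop. *)
  have [E|[u [c [v E]]]] : [\/ [/\ outw w' = w, inw w' = [::] & eps w' = false] |
      exists u c v, w = u ++ (c, None, None) :: v].
    rewrite {}/w'; elim: w => [|[[c [i|]] [j|]] w IH] /=; first by left.
    1-4: case: IH => [[-> -> ->]|[u [d [v ->]]]]; [try by left|right].
    * by exists ((c, Some i, Some j) :: u), d, v.
    * by exists ((c, Some i, None) :: u), d, v.
    * by exists ((c, None, Some j) :: u), d, v.
    * by right; exists [::], c, w.
    * by exists ((c, None, None) :: u), d, v.
  + by case: E => -> -> ->; rewrite /= mulr1 mul1r.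
  + rewrite {}/w' E (adm_diag _ _ _ _ (adm_pairing x)).
    by rewrite /wmap map_cat inw_cat /=; case: (inw _) => [|? ?] /=; rewrite !mulr0.
- by case=> [|[[c x] y] w].
- by case=> [|[[[] [] ] []] []]; rewrite /= ?mulr0 //; ring.
- by case=> [|[[[] [] ] []] []]; rewrite /= ?mulr0 //; ring.
- apply: pairing_eq3 => [w w2|w w2|//|c x|c x d y].
  + exact: pairing_comp3_long.
  + by rewrite pairing_map pairing_comp3_long ?size_map.
  + by case: c x => [] [[]|[]]; rewrite /= /wcomp /=; ring.
  + by case: c x d y => [] [[]|[]] [] [[]|[]]; rewrite /= /wcomp /=; ring.
- apply: pairing_eq3 => [w w2|//||c x|c x d y].
  + by rewrite /cycl !pairing_add !pairing_map !pairing_comp3_long ?size_map // !addr0.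
  + by rewrite /= /wcomp /=; ring.
  + by case: c x => [] [[]|[]]; rewrite /= /wcomp /=; ring.
  + by case: c x d y => [] [[]|[]] [] [[]|[]]; rewrite /= /wcomp /=; ring.
- apply: pairing_eq3 => [w w2|//||c x|c x d y].
  + by rewrite /cycl !(pairing_add, pairing_map) !pairing_comp3_long ?size_map // !addr0.
  + by rewrite /= /wcomp /=; ring.
  + by case: c x => [] [[]|[]]; rewrite /= /wcomp /=; ring.
  + by case: c x d y => [] [[]|[]] [] [[]|[]]; rewrite /= /wcomp /=; ring.
- apply: pairing_eq3 => [w w2|w w2||c x|c x d y].
  + exact: pairing_comp3_long.
  + by rewrite !(pairing_add, pairing_map) !pairing_comp3_long ?size_map // !addr0.
  + by rewrite /= /wcomp /=; ring.
  + by case: c x => [] [[]|[]]; rewrite /= /wcomp /=; ring.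
  + by case: c x d y => [] [[]|[]] [] [[]|[]]; rewrite /= /wcomp /=; ring.
- apply: pairing_eq3 => [w w2|w w2||c x|c x d y].
  + exact: pairing_comp3_long.
  + by rewrite !(pairing_add, pairing_map) !pairing_comp3_long ?size_map // !addr0.
  + by rewrite /= /wcomp /=; ring.
  + by case: c x => [] [[]|[]]; rewrite /= /wcomp /=; ring.
  + by case: c x d y => [] [[]|[]] [] [[]|[]]; rewrite /= /wcomp /=; ring.
Qed.

End RamWords.

(** * Cocomposition of words *)

Section WordClasses.
Context {K : fieldType} {I : FiniteSet}.
Notation R := (Ralg K I).
Implicit Types (x y : R) (t : R_term K I).

Lemma R_clsK x : R_cls (rep x) = x.
Proof. exact: (repK (M := R_pres I)). Qed.

Lemma R_rep_cls t : R_eqv (rep (R_cls t)) t.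
Proof. exact: (rep_cls (M := R_pres I)). Qed.

Lemma R_clsP t u : R_eqv t u -> R_cls t = R_cls u.
Proof. by move/(clsP (M := R_pres I)). Qed.

Lemma R_scalerAl k x y : (k *: x) * y = k *: (x * y).
Proof.
rewrite -[x]R_clsK -[y]R_clsK -R_clsZ -!R_clsM -R_clsZ.
by apply: R_clsP => E hE; apply: (rc_mulZl hE).
Qed.

Lemma R_scalerAr k x y : x * (k *: y) = k *: (x * y).
Proof.
rewrite -[x]R_clsK -[y]R_clsK -R_clsZ -!R_clsM -R_clsZ.
by apply: R_clsP => E hE; apply: (rc_mulZr hE).
Qed.

Definition wcls (w : word I) : R :=
  foldr (fun e x => R_gen e.1.1 e.1.2 e.2 * x) 1 w.

Lemma wcls_cat u v : wcls (u ++ v) = wcls u * wcls v.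
Proof. by elim: u => [|e u IH] /=; rewrite ?mul1r // IH mulrA. Qed.

Lemma R_clsE t : R_cls t = lin t wcls.
Proof.
elim: t => //= [s IHs t IHt|k s IH|s IHs t IHt|c i j].
- by rewrite R_clsD IHs IHt.
- by rewrite R_clsZ IH.
- rewrite R_clsM IHs IHt (lin_linear (h := fun x => x * lin t wcls)).
    apply: eq_lin => u /=; rewrite (lin_linear (h := fun x => wcls u * x)).
      by apply: eq_lin => v; rewrite /= wcls_cat.
    by move=> k x y; rewrite mulrDr R_scalerAr.
  by move=> k x y; rewrite mulrDl R_scalerAl.
- by rewrite mulr1.
Qed.

Lemma wcls_rel r : Rrel r -> \sum_(w <- r) wcls w = 0.
Proof.
have z t : (forall E, R_congr E -> E t RZero) -> lin t wcls = 0.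
  by move=> h; rewrite -R_clsE; apply: (R_clsP (u := RZero)).
case=> {r} [c i|c i j ij|i j ij|i j k H|i j k H|c i0 i1 s H|c i j k l H].
- rewrite big_seq1; apply: (z (RGen c i i)) => E hE; exact: (rc_diag hE).
- rewrite big_cons big_seq1; apply: (z (RAdd (RGen c j i) (RGen c i j))) => E hE.
  apply: (lc_trans hE _ (lc_addN hE (RGen c i j))); apply: (lc_add hE).
    exact: (rc_anti hE).
  exact: (lc_refl hE).
- rewrite big_seq1; apply: (z (RMul (RGen ga i j) (RGen ga i j))) => E hE; exact: (rc_aa hE).
- by rewrite -[RHS](z _ (fun E hE => rc_arnold hE H)) lin_sum !big_cons !big_nil.
- by rewrite -[RHS](z _ (fun E hE => rc_mixed hE H)) lin_sum !big_cons !big_nil.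
- rewrite big_seq1 /=; case: c.
    by have := z _ (fun E hE => rc_cycle_ab hE H); rewrite /= lin_b_chain.
  by have := z _ (fun E hE => rc_cycle_bb hE H); rewrite /= lin_b_chain.
- case: c.
    by rewrite -[RHS](z _ (fun E hE => rc_bab hE H)) lin_sum !big_cons !big_nil.
  by rewrite -[RHS](z _ (fun E hE => rc_bbb hE H)) lin_sum !big_cons !big_nil.
Qed.

(** This is the universal admissible function: composing it with a linear functional on R(I) yields
    an admissible function again. *)
Lemma adm_wcls : adm wcls.
Proof.
split=> [u v e1 e2|r hr u v].
  rewrite !wcls_cat /= -R_scalerAr; congr (_ * _); rewrite !mulrA -R_scalerAl.
  congr (_ * _); rewrite /R_gen -!R_clsM -R_clsZ; apply: R_clsP => E hE.
  have := rc_comm hE (RhGen K e1.1.1 e1.1.2 e1.2) (RhGen K e2.1.1 e2.1.2 e2.2).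
  by case: e1 e2 => [[[] ?] ?] [[[] ?] ?].
under eq_bigr do rewrite !wcls_cat.
by rewrite -mulr_sumr -mulr_suml (wcls_rel hr) mul0r mulr0.
Qed.

Lemma adm_linE (V : lmodType K) (f : word I -> V) t : adm f -> lin (rep (R_cls t)) f = lin t f.
Proof. by move=> fA; apply: (adm_lin fA); apply: R_rep_cls. Qed.

Lemma rep_scale_add k x y : R_eqv (rep (k *: x + y)) (RAdd (RScale k (rep x)) (rep y)).
Proof.
by apply/(clsP (M := R_pres I)); rewrite -/(R_cls _) R_clsK -/(R_cls _) R_clsD R_clsZ !R_clsK.
Qed.

Lemma lin_rep_linear (V : lmodType K) (f : word I -> V) k x y : adm f ->
  lin (rep (k *: x + y)) f = k *: lin (rep x) f + lin (rep y) f.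
Proof. by move=> fA; rewrite (adm_lin fA (rep_scale_add k x y)). Qed.

Lemma lin_sgn (V : lmodType K) t (f : word I -> V) :
  lin (R_sgn_term t) f = lin t (fun w => (-1) ^+ wodd w *: f w).
Proof.
elim: t f => //= [s IHs t IHt|k s IH||s IHs t IHt|c i j] f.
- by rewrite IHs IHt.
- by rewrite IH.
- by rewrite scale1r.
- rewrite IHs; apply: eq_lin => u; rewrite IHt -linZ; apply: eq_lin => v.
  by rewrite scalerA wodd_cat signr_addb.
- by case: c; rewrite /= ?expr0 ?expr1 ?expr0z ?expr1z.
Qed.

Lemma R_sgn_lin x : R_sgn x = lin (rep x) (fun w => (-1) ^+ wodd w *: wcls w).
Proof. by rewrite /R_sgn R_clsE lin_sgn. Qed.

Lemma adm_twist (V : lmodType K) (f : word I -> V) :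
  adm f -> adm (fun w => (-1) ^+ wodd w *: f w).
Proof.
move=> /(adm_ctx true [::] [::]); congr adm.
by apply/funext => w; rewrite cats0.
Qed.

Lemma R_sgn_linear k x y : R_sgn (k *: x + y) = k *: R_sgn x + R_sgn y.
Proof. by rewrite !R_sgn_lin lin_rep_linear //; apply/adm_twist/adm_wcls. Qed.

(** [wcls] lives in the quotient while [lin] acts on expressions; this supplies an expression on
    which [lin] returns [f w] for every [f] at once. *)
Lemma wcls_term w : exists t, wcls w = R_cls t /\
  forall (V : lmodType K) (f : word I -> V), lin t f = f w.
Proof.
elim: w => [|[[c i] j] w [t [E H]]]; first by exists (ROne).
exists (RMul (RGen c i j) t); split=> [|V f]; first by rewrite /= R_clsM E.
by rewrite /= H.
Qed.

Lemma R_sgn_wcls w : R_sgn (wcls w) = (-1) ^+ wodd w *: wcls w.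
Proof.
have [t [E H]] := wcls_term w.
by rewrite R_sgn_lin E adm_linE ?H; [rewrite -E|apply/adm_twist/adm_wcls].
Qed.

Hypothesis char2 : (2 : K) != 0.

Lemma R_even_wcls w : R_even (wcls w) = (~~ wodd w)%:R *: wcls w.
Proof.
rewrite /R_even R_sgn_wcls; case: (wodd w); rewrite /= ?expr1 ?expr0.
  by rewrite scaleN1r subrr scaler0 scale0r.
by rewrite !scale1r -mulr2n -scaler_nat scalerA mulVf // scale1r.
Qed.

Lemma R_odd_wcls w : R_odd (wcls w) = (wodd w)%:R *: wcls w.
Proof.
rewrite /R_odd R_sgn_wcls; case: (wodd w); rewrite /= ?expr1 ?expr0.
  by rewrite scaleN1r opprK !scale1r -mulr2n -scaler_nat scalerA mulVf // scale1r.
by rewrite scale1r subrr scaler0 scale0r.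
Qed.

Lemma R_even_linear k x y : R_even (k *: x + y) = k *: R_even x + R_even y.
Proof.
by rewrite /R_even R_sgn_linear scalerA mulrC -scalerA -scalerDr scalerDr addrACA -!scalerDr.
Qed.

Lemma R_odd_linear k x y : R_odd (k *: x + y) = k *: R_odd x + R_odd y.
Proof.
rewrite /R_odd R_sgn_linear scalerA mulrC -scalerA -scalerDr; congr (_ *: _).
by rewrite opprD addrACA -scalerN -scalerDr.
Qed.

End WordClasses.

Section ThetaWords.
Context {K : fieldType} {I J : FiniteSet}.
Hypothesis char2 : (2 : K) != 0.
Notation R := (Ralg K).
Notation TT := (tensor (R (option I)) (R J)).

Definition Theta_word (w : word (I + J)%type) : TT :=
  (-1) ^+ eps w *: tens (wcls (outw w)) (wcls (inw w)).

Let mulB (u : R (option I)) (v : R J) (u' : R (option I)) (v' : R J) : TT :=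
  tens (u * u') (R_even v * v') + tens (u * R_sgn u') (R_odd v * v').

Let mulB_lin3 k u v u' u'' v' : mulB u v (k *: u' + u'') v' = k *: mulB u v u' v' + mulB u v u'' v'.
Proof.
by rewrite /mulB R_sgn_linear !mulrDr !R_scalerAr !tensDl scalerDr addrACA.
Qed.

Let mulB_lin4 k u v u' v' v'' : mulB u v u' (k *: v' + v'') = k *: mulB u v u' v' + mulB u v u' v''.
Proof.
by rewrite /mulB !mulrDr !R_scalerAr !tensDr scalerDr addrACA.
Qed.

Let mulB_lin1 k u u0 v u' v' : mulB (k *: u + u0) v u' v' = k *: mulB u v u' v' + mulB u0 v u' v'.
Proof.
by rewrite /mulB !mulrDl !R_scalerAl !tensDl scalerDr addrACA.
Qed.

Let mulB_lin2 k u v v0 u' v' : mulB u (k *: v + v0) u' v' = k *: mulB u v u' v' + mulB u v0 u' v'.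
Proof.
by rewrite /mulB R_even_linear R_odd_linear !mulrDl !R_scalerAl !tensDr scalerDr addrACA.
Qed.

Lemma R_tens_mul_linear_r (s : TT) k t t' :
  R_tens_mul s (k *: t + t') = k *: R_tens_mul s t + R_tens_mul s t'.
Proof.
apply: tens_lift_comb => u v.
rewrite (tens_liftD (B := mulB u v)) ?(tens_liftZ (B := mulB u v)) //.
Qed.

Lemma R_tens_mul_linear_l (t : TT) k s s' :
  R_tens_mul (k *: s + s') t = k *: R_tens_mul s t + R_tens_mul s' t.
Proof.
rewrite /R_tens_mul tens_liftD ?tens_liftZ // => *.
- by apply: tens_lift_comb => u' v'; apply: mulB_lin1.
- by apply: tens_lift_comb => u' v'; apply: mulB_lin2.
- by apply: tens_lift_comb => u' v'; apply: mulB_lin1.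
- by apply: tens_lift_comb => u' v'; apply: mulB_lin2.
Qed.

Lemma R_tens_mul_tens u v u' v' : R_tens_mul (tens u v : TT) (tens u' v') = mulB u v u' v'.
Proof.
rewrite /R_tens_mul tens_lift_tens ?(tens_lift_tens (B := mulB u v)) // => *.
- by apply: tens_lift_comb => a b; apply: mulB_lin1.
- by apply: tens_lift_comb => a b; apply: mulB_lin2.
Qed.

(** On a monomial only one of the even and odd parts in [R_tens_mul] survives, and it produces the
    cross term of [eps_cat]. *)
Lemma Theta_word_cat u v : R_tens_mul (Theta_word u) (Theta_word v) = Theta_word (u ++ v).
Proof.
rewrite /Theta_word.
have tZl k (x y : TT) : R_tens_mul (k *: x) y = k *: R_tens_mul x y.
  have := R_tens_mul_linear_l y (-1) x x.
  rewrite !scaleN1r !addNr => h0.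
  by rewrite -[k *: x in LHS]addr0 R_tens_mul_linear_l h0 addr0.
have tZr k (x y : TT) : R_tens_mul x (k *: y) = k *: R_tens_mul x y.
  have := R_tens_mul_linear_r x (-1) y y.
  rewrite !scaleN1r !addNr => h0.
  by rewrite -[k *: y in LHS]addr0 R_tens_mul_linear_r h0 addr0.
rewrite tZl tZr R_tens_mul_tens /mulB R_even_wcls // R_odd_wcls // R_sgn_wcls.
rewrite outw_cat inw_cat eps_cat !wcls_cat R_scalerAr !R_scalerAl !tensZr tensZl !scalerA.
rewrite !signr_addb; case: (wodd (inw u)) => /=.
  by rewrite scale0r add0r mul1r scalerA.
by rewrite scale1r mul0r scale0r addr0 mulr1.
Qed.

Lemma Theta_termE (t : R_term K (I + J)%type) : Theta_term t = lin t Theta_word.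
Proof.
elim: t => //= [s -> t ->|k s ->||s -> t ->|c x y] //.
- by rewrite /Theta_word scale1r.
- rewrite (lin_linear (h := fun x => R_tens_mul x (lin t Theta_word))).
    apply: eq_lin => u /=; rewrite (lin_linear (h := fun x => R_tens_mul (Theta_word u) x)).
      by apply: eq_lin => v; rewrite /= Theta_word_cat.
    by move=> *; rewrite R_tens_mul_linear_r.
  by move=> *; rewrite R_tens_mul_linear_l.
- by case: x y => [i|i] [j|j]; rewrite /Theta_word /= ?andbF expr0 scale1r ?mulr1.
Qed.

End ThetaWords.

(** * Differentials *)

Section Derivations.
Context {K : fieldType}.
(** Treats d and d' together: [delta c] is the letter replacing [c], and [None] means that [c] is
    sent to 0. *)
Variable delta : ab -> option ab.
Hypothesis delta_odd : forall c c', delta c = Some c' ->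
  forall (I : FiniteSet) (x y : I), eodd (c', x, y) = ~~ eodd (c, x, y).

(** The transpose of the odd derivation of words extending [delta]. *)
Fixpoint word_der (I : FiniteSet) (V : lmodType K) (f : word I -> V) (w : word I) : V :=
  if w is e :: w' then
    (if delta e.1.1 is Some c then f ((c, e.1.2, e.2) :: w') else 0) +
    (-1) ^+ eodd e *: word_der (fun x => f (e :: x)) w'
  else 0.

Section WordDer.
Context {I : FiniteSet} {V : lmodType K}.
Implicit Types f g : word I -> V.

Lemma eq_word_der f g : f =1 g -> word_der f =1 word_der g.
Proof.
move=> E w; elim: w f g E => //= e w IH f g E.
rewrite (IH _ (fun x => g (e :: x))); last by move=> x; apply: E.
by case: (delta _) => // c; rewrite E.
Qed.

Lemma word_der_comb k f g w :
  word_der (fun x => k *: f x + g x) w = k *: word_der f w + word_der g w.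
Proof.
elim: w f g => /= [|e w IH] f g; first by rewrite scaler0 addr0.
rewrite IH !scalerDr addrACA !scalerA [_ * k]mulrC; congr (_ + _).
by case: (delta _) => // *; rewrite scaler0 addr0.
Qed.

Lemma word_der0 w : word_der (fun _ : word I => 0 : V) w = 0.
Proof. by elim: w => //= e w ->; case: (delta _) => *; rewrite scaler0 addr0. Qed.

Lemma word_derZ k f w : word_der (fun x => k *: f x) w = k *: word_der f w.
Proof.
rewrite -[RHS]addr0 -(word_der0 w) -word_der_comb; apply: eq_word_der => x; by rewrite addr0.
Qed.

Lemma word_der_cat f u v : word_der f (u ++ v) =
  word_der (fun x => f (x ++ v)) u + (-1) ^+ wodd u *: word_der (fun y => f (u ++ y)) v.
Proof.
elim: u f => /= [|e u IH] f; first by rewrite add0r scale1r; apply: eq_word_der.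
by rewrite IH scalerDr addrA scalerA signr_addb.
Qed.

Lemma word_der_lin (J : FiniteSet) (t : R_term K J) (F : word I -> word J -> V) w :
  word_der (fun x => lin t (F x)) w = lin t (fun v => word_der (fun x => F x v) w).
Proof.
elim: w F => /= [|e w IH] F; first by rewrite lin0.
rewrite IH -linZ; case: (delta _) => [c|]; first by rewrite -linD.
by rewrite add0r; apply: eq_lin => v; rewrite add0r.
Qed.

Lemma lin_der (D : ab -> I -> I -> R_term K I) t f :
  (forall c i j f, lin (D c i j) f = if delta c is Some c' then f [:: (c', i, j)] else 0) ->
  lin (R_der_term D t) f = lin t (word_der f).
Proof.
move=> HD; elim: t f => //= [s IHs t IHt|k s IH|s IHs t IHt|c i j] f.
- by rewrite IHs IHt.
- by rewrite IH.
- rewrite IHs lin_sgn -linD; apply: eq_lin => u; rewrite IHt word_der_lin -linZ -linD.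
  by apply: eq_lin => v; rewrite word_der_cat.
- by rewrite HD scaler0 addr0.
Qed.

(** The derivation flips the parity of the word at which [f] is evaluated, whence the negation in
    the sign. *)
Lemma word_der_twist f w :
  word_der (fun x => (-1) ^+ wodd x *: f x) w = (-1) ^+ (~~ wodd w) *: word_der f w.
Proof.
elim: w f => /= [|e w IH] f; first by rewrite scaler0.
have -> : word_der (fun x => (-1) ^+ (eodd e (+) wodd x) *: f (e :: x)) w =
    (-1) ^+ eodd e *: word_der (fun x => (-1) ^+ wodd x *: f (e :: x)) w.
  by rewrite -word_derZ; apply: eq_word_der => x; rewrite scalerA -signr_addb.
rewrite IH scalerDr !scalerA -!signr_addb; congr (_ + _ ^+ _ *: _).
  case E: (delta _) => [c|]; rewrite ?scaler0 //.
  have := delta_odd E e.1.2 e.2; rewrite -surjective_pairing -surjective_pairing => ->.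
  by rewrite addNb.
by case: (eodd e); case: (wodd w).
Qed.

End WordDer.

Lemma word_der_wmap (I J : FiniteSet) (V : lmodType K) (h : I -> J) (f : word J -> V) w :
  word_der (f \o wmap h) w = word_der f (wmap h w).
Proof. by elim: w f => //= e w IH f; rewrite -IH. Qed.

Lemma wcomp_outer (I J : FiniteSet) (f : word (option I) -> K^o) (g : word J -> K^o) e o w :
  outer e = Some o -> wcomp f g (e :: w) = wcomp (fun x => f (o :: x)) g w.
Proof. by rewrite /wcomp /=; case: (edgeP e) => // o' _ [->]; rewrite addbF. Qed.

Lemma wcomp_inner (I J : FiniteSet) (f : word (option I) -> K^o) (g : word J -> K^o) e i w :
  inner e = Some i -> wcomp f g (e :: w) =
  wcomp (fun x => (-1) ^+ (eodd i && wodd x) *: f x) (fun y => g (i :: y)) w.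
Proof.
rewrite /wcomp /=; case: (edgeP e) => // i' _ [->] /=.
by rewrite signr_addb /GRing.scale /= !mulrA.
Qed.

(** The Leibniz rule dual to that of Ram. As [f] is not assumed homogeneous, the sign of the first
    factor is read off from the word on which it is evaluated. *)
Lemma word_der_wcomp (I J : FiniteSet) (f : word (option I) -> K^o) (g : word J -> K^o) w :
  word_der (wcomp f g) w =
  wcomp (word_der f) g w + wcomp (fun x => (-1) ^+ wodd x *: f x) (word_der g) w.
Proof.
elim: w f g => [|[[c x] y] w IH] f g; first by rewrite /wcomp /=; ring.
have H1 x' y' : (forall c, outer (c, x, y) = Some (c, x', y')) ->
    word_der (wcomp f g) ((c, x, y) :: w) = wcomp (word_der f) g ((c, x, y) :: w) +
    wcomp (fun x => (-1) ^+ wodd x *: f x) (word_der g) ((c, x, y) :: w).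
  move=> o; rewrite [LHS]/= !(wcomp_outer _ _ _ (o _)).
  rewrite (eq_word_der (fun z => wcomp_outer f g z (o c))) IH.
  have -> : eodd (c, x, y) = eodd (c, x', y') by [].
  case D: (delta c) => [c'|];
    rewrite ?(wcomp_outer _ _ _ (o _)) /wcomp /= D /GRing.scale /= signr_addb; ring.
case: x y H1 => [i|i] [j|j] H1; [exact: H1|exact: H1|exact: H1|] => {H1}.
have o c' : inner ((c', inr i, inr j) : edge (I + J)%type) = Some (c', i, j) by [].
rewrite [LHS]/= !(wcomp_inner _ _ _ (o _)).
rewrite (eq_word_der (fun z => wcomp_inner f g z (o c))) IH.
rewrite /wcomp.
(* An odd inner letter twists [f] by the parity, and moving the derivation across that twist costs
   one more sign. *)
have -> : word_der (fun x => (-1) ^+ (eodd (c, i, j) && wodd x) *: f x) (outw w) =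
    (-1) ^+ (eodd (c, i, j) && ~~ wodd (outw w)) *: word_der f (outw w).
  case: (eodd _) => /=; first exact: word_der_twist.
  by rewrite scale1r; apply: eq_word_der => z; rewrite scale1r.
case D: (delta c) => [c'|]; rewrite /= D /wcomp /GRing.scale /=.
  rewrite !(delta_odd D) -![eodd (c, inr i, inr j)]/(eodd (c, i, j)).
  by case: (eodd (c, i, j)); case: (wodd (outw w)); case: (eps w); rewrite /= ?expr0 ?expr1; ring.
rewrite -![eodd (c, inr i, inr j)]/(eodd (c, i, j)).
by case: (eodd (c, i, j)); case: (wodd (outw w)); case: (eps w); rewrite /= ?expr0 ?expr1; ring.
Qed.

End Derivations.

(** * Parity, differentials and coproduct of Ram in terms of words *)

Section RamPairing.
Context {K : fieldType}.

Lemma wodd_gen_word g (w : word bool) :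
  (-1) ^ (ram_gen_deg g).1 * gen_word g w = (-1) ^+ wodd w * gen_word g w :> K.
Proof.
by case: g w => [] [|[[[] x] y] [|? ?]]; rewrite /= ?mulr0 ?expr0z ?expr1z.
Qed.

Lemma pairing_sgn I (M : ram_term K I) w :
  pairing (ram_sgn_term M) w = (-1) ^+ wodd w * pairing M w.
Proof.
elim: M w => //= {I} [I|I x IHx y IHy|I k x IH|I J s x IH||I J x IHx y IHy|g] w.
- by rewrite mulr0.
- by rewrite IHx IHy mulrDr.
- by rewrite IH mulrCA.
- by rewrite IH wodd_wmap.
- by case: w => [|? ?] /=; rewrite ?mul1r ?mulr0.
- by rewrite /wcomp IHx IHy wodd_unshuffle signr_addb; ring.
- exact: wodd_gen_word.
Qed.

(** Both sides obey the same Leibniz rule, which reduces the comparison to the generators. *)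
Lemma pairing_der (delta : ab -> option ab) (D : ram_gen -> ram_term K bool) I (M : ram_term K I) :
  (forall c c', delta c = Some c' ->
    forall (I : FiniteSet) (x y : I), eodd (c', x, y) = ~~ eodd (c, x, y)) ->
  (forall g, pairing (D g) =1 word_der delta (gen_word g)) ->
  pairing (ram_der_term D M) =1 word_der delta (pairing M).
Proof.
move=> dodd HD.
elim: M => {I} [I|I x IHx y IHy|I k x IH|I J s x IH||I J x IHx y IHy|g] w.
- by rewrite /= word_der0.
- rewrite /= IHx IHy -[X in X + _]scale1r -word_der_comb.
  by apply: eq_word_der => z; rewrite scale1r.
- by rewrite /= IH -[RHS]/(word_der delta (fun z => k *: (pairing x z : K^o)) w) word_derZ.
- by rewrite /= IH -word_der_wmap.
- case: w => //= e w; rewrite (eq_word_der delta (g := fun=> 0)) // word_der0 scaler0 addr0.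
  by case: (delta _).
- rewrite [pairing (MComp _ _)]/= word_der_wcomp //= /wcomp IHx IHy pairing_sgn.
  by [].
- exact: HD.
Qed.

Definition qpairing I (r : Ram K I) : word I -> K^o := pairing (ram_rep r).

Lemma qpairing_cls I (M : ram_term K I) w : qpairing (ram_cls M) w = pairing M w.
Proof.
exact: (rep_cls (M := @ram_pres K I) M
  (fun I (x y : ram_term K I) => pairing x =1 pairing y) pairing_ram_congr w).
Qed.

Lemma ram_clsK I (r : Ram K I) : ram_cls (ram_rep r) = r.
Proof. exact: (repK (M := @ram_pres K I)). Qed.

Lemma qpairing_linear I k (r s : Ram K I) w :
  qpairing (k *: r + s) w = k * qpairing r w + qpairing s w.
Proof.
rewrite -[X in qpairing X _](_ : ram_cls (MAdd (MScale k (ram_rep r)) (ram_rep s)) = _).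
  by rewrite qpairing_cls.
rewrite /ram_cls (clsD (M := @ram_pres K I)) (clsZ (M := @ram_pres K I)).
by rewrite -!/(ram_cls _) !ram_clsK.
Qed.

Lemma qpairing_map I J (s : bij I J) (r : Ram K I) w :
  qpairing (ram_map s r) w = qpairing r (wmap (bij_inv s) w).
Proof. by rewrite /ram_map qpairing_cls. Qed.

Lemma qpairing_comp (I J : FiniteSet) (r : Ram K (option I)) (s : Ram K J) w :
  qpairing (ram_comp r s) w = wcomp (qpairing r) (qpairing s) w.
Proof. by rewrite /ram_comp qpairing_cls. Qed.

Lemma qpairing_sgn I (r : Ram K I) w : qpairing (ram_sgn r) w = (-1) ^+ wodd w * qpairing r w.
Proof. by rewrite /ram_sgn qpairing_cls pairing_sgn. Qed.

Hypothesis char2 : (2 : K) != 0.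

Lemma qpairing_0 I w : qpairing (0 : Ram K I) w = 0.
Proof.
have := qpairing_linear (-1) (0 : Ram K I) 0 w.
by rewrite scaler0 addr0 mulN1r addNr.
Qed.

Lemma qpairing_even I (r : Ram K I) w : qpairing (ram_even r) w = (~~ wodd w)%:R * qpairing r w.
Proof.
rewrite /ram_even -[_ *: _]addr0 qpairing_linear qpairing_0.
rewrite -[X in qpairing (X + _) _]scale1r qpairing_linear qpairing_sgn.
by case: (wodd w); rewrite /= ?expr0 ?expr1; field.
Qed.

Lemma qpairing_odd I (r : Ram K I) w : qpairing (ram_odd r) w = (wodd w)%:R * qpairing r w.
Proof.
rewrite /ram_odd -[_ *: _]addr0 qpairing_linear qpairing_0.
rewrite [r - _]addrC -scaleN1r qpairing_linear qpairing_sgn.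
by case: (wodd w); rewrite /= ?expr0 ?expr1; field.
Qed.

Definition pair2 I (u v : word I) (t : tensor (Ram K I) (Ram K I)) : K^o :=
  tens_lift (fun r s => qpairing r u * qpairing s v : K^o) t.

Section Pair2.
Context {I : FiniteSet} (u v : word I).

Let pair2_l k (r r' s : Ram K I) :
  (qpairing (k *: r + r') u * qpairing s v : K^o) =
  k *: (qpairing r u * qpairing s v : K^o) + qpairing r' u * qpairing s v.
Proof. by rewrite qpairing_linear /GRing.scale /= mulrDl mulrA. Qed.

Let pair2_r k (r s s' : Ram K I) :
  (qpairing r u * qpairing (k *: s + s') v : K^o) =
  k *: (qpairing r u * qpairing s v : K^o) + qpairing r u * qpairing s' v.
Proof. by rewrite qpairing_linear /GRing.scale /= mulrDr mulrCA. Qed.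

Lemma pair2_tens r s : pair2 u v (tens r s) = qpairing r u * qpairing s v.
Proof. exact: tens_lift_tens. Qed.

Lemma pair2_linear k t t' : pair2 u v (k *: t + t') = k *: pair2 u v t + pair2 u v t'.
Proof. by rewrite /pair2 tens_liftD ?tens_liftZ. Qed.

Lemma pair2D t t' : pair2 u v (t + t') = pair2 u v t + pair2 u v t'.
Proof. by rewrite -[t]scale1r pair2_linear !scale1r. Qed.

Lemma pair20 : pair2 u v 0 = 0.
Proof. by have := pair2_linear (-1) 0 0; rewrite scaler0 addr0 scaleN1r addNr. Qed.

End Pair2.

Lemma pair2_coprod_gen g u v : pair2 u v (ram_coprod_gen g) = gen_word g (u ++ v).
Proof.
by case: g; rewrite /ram_coprod_gen ?pair2D !pair2_tens !qpairing_cls;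
  case: u v => [|[[[] ?] ?] [|? ?]] [|[[[] ?] ?] [|? ?]];
  rewrite /= ?(mul0r, mulr0, mul1r, mulr1, add0r, addr0).
Qed.

Lemma pair2_coprod I (M : ram_term K I) u v :
  pair2 u v (ram_coprod_term M) = pairing M (u ++ v).
Proof.
elim: M u v => {I} [I|I x IHx y IHy|I k x IH|I J s x IH||I J x IHx y IHy|g] u v /=.
- exact: pair20.
- by rewrite pair2D IHx IHy.
- by rewrite -[k *: _]addr0 pair2_linear pair20 addr0 IH.
- rewrite tens_lift_linear; last exact: pair2_linear.
  rewrite /wmap map_cat -IH; apply: eq_tens_lift => r t.
  by rewrite pair2_tens !qpairing_map.
- by rewrite pair2_tens !qpairing_cls; case: u v => [|? ?] [|? ?];
    rewrite /= ?mulr1 ?mulr0.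
- rewrite /ram_tens_comp tens_lift_linear; last exact: pair2_linear.
  rewrite /wcomp outw_cat inw_cat -IHx -IHy.
  move: (ram_coprod_term x) (ram_coprod_term y) => S T.
  rewrite [X in _ = _ * X]mulrC mulrA -[RHS]/(_ *: (pair2 _ _ _)) -tens_lift_scale.
  apply: eq_tens_lift => r r'; rewrite tens_lift_linear; last exact: pair2_linear.
  rewrite [RHS]/GRing.scale /= [RHS]mulrAC.
  rewrite -[RHS]/(_ *: (pair2 _ _ _)) -tens_lift_scale; apply: eq_tens_lift => s s'.
  (* Here [r'] is evaluated on [outw v] and [s] on [inw u], so the even and odd parts of [r'] give
     exactly the cross term of [eps_cat]. *)
  rewrite pair2D !pair2_tens !qpairing_comp /wcomp qpairing_even qpairing_odd qpairing_sgn eps_cat.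
  rewrite !signr_addb /GRing.scale /=.
  by case: (wodd (inw u)); case: (wodd (outw v)); rewrite /= ?expr0 ?expr1; ring.
- exact: pair2_coprod_gen.
Qed.

End RamPairing.

(** * The map of Hopf operads *)

Section Rho.
Context {K : fieldType}.

Definition rho_fun I (r : Ram K I) (x : Ralg K I) : K^o := lin (rep x) (qpairing r).

Lemma rho_fun_is_linear I (r : Ram K I) : linear (rho_fun r).
Proof. by move=> k x y; apply: lin_rep_linear; apply: adm_pairing. Qed.

HB.instance Definition _ I (r : Ram K I) :=
  GRing.isLinear.Build K (Ralg K I) K^o *:%R (rho_fun r) (rho_fun_is_linear r).

Definition rho I (r : Ram K I) : Rdual K I := rho_fun r.

Lemma rhoE I (r : Ram K I) x : rho r x = lin (rep x) (qpairing r).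
Proof. by []. Qed.

Lemma rho_cls I (r : Ram K I) t : rho r (R_cls t) = lin t (qpairing r).
Proof. by rewrite rhoE adm_linE //; apply: adm_pairing. Qed.

Lemma rho_wcls I (r : Ram K I) w : rho r (wcls w) = qpairing r w.
Proof. by have [t [-> H]] := wcls_term (K := K) w; rewrite rho_cls H. Qed.

Lemma Rdual_lin I (f : Rdual K I) x : f x = lin (rep x) (fun w => f (wcls w)) :> K^o.
Proof.
by rewrite -[in LHS](R_clsK x) R_clsE lin_linear // => k a b; rewrite linearP.
Qed.

Lemma lin_map (V : lmodType K) (I J : FiniteSet) (h : I -> J) t (f : word J -> V) :
  lin (R_map_term h t) f = lin t (f \o wmap h).
Proof.
elim: t f => //= [s IHs t IHt|k s IH|s IHs t IHt] f; rewrite ?IHs ?IHt ?IH //.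
by apply: eq_lin => u /=; rewrite IHt; apply: eq_lin => v; rewrite /= /wmap map_cat.
Qed.

Lemma Rdual_map_lin I J (s : bij I J) (f : Rdual K I) y :
  Rdual_map s f y = lin (rep y) ((fun w => f (wcls w)) \o wmap (bij_inv s)) :> K^o.
Proof.
rewrite /Rdual_map /R_map R_clsE (lin_linear (h := f : _ -> K^o)).
  by rewrite lin_map.
by move=> k a b; rewrite linearP.
Qed.

Hypothesis char2 : (2 : K) != 0.

(** Identifies the composition of the dual, defined by transposing the cocomposition, with the
    explicit [wcomp]. *)
Lemma Rdual_comp_lin (I J : FiniteSet) (f : Rdual K (option I)) (g : Rdual K J) x :
  Rdual_comp f g x = lin (rep x) (wcomp (fun w => f (wcls w)) (fun w => g (wcls w))) :> K^o.
Proof.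
have l1 k u u' v : (f (k *: u + u') * g v : K^o) = k *: (f u * g v : K^o) + f u' * g v.
  by rewrite linearP /GRing.scale /= mulrDl mulrA.
have l2 k u v v' : (f u * g (k *: v + v') : K^o) = k *: (f u * g v : K^o) + f u * g v'.
  by rewrite linearP /GRing.scale /= mulrDr mulrCA.
rewrite /Rdual_comp /tens_form /Theta Theta_termE // (lin_linear (h := @tens_lift K _ _ K^o _)).
  apply: eq_lin => w /=; rewrite /Theta_word tens_liftZ //.
  by rewrite tens_lift_tens.
by move=> k a b; rewrite tens_liftD // tens_liftZ.
Qed.

Lemma qpairing_homog I p (r : Ram K I) w : ram_homog p r -> wdeg w <> p -> qpairing r w = 0.
Proof. by case=> M hM -> h; rewrite qpairing_cls (pairing_hdeg hM). Qed.

Lemma rho_hopf : is_hopf_operad_map rho.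
Proof.
split.
- move=> I k r s x; rewrite !rhoE.
  transitivity (lin (rep x) (fun w => k *: qpairing r w + qpairing s w)); last exact: lin_comb.
  by apply: eq_lin => w; rewrite qpairing_linear.
- move=> I p r hr q x qp [t ht ->]; rewrite rho_cls -[RHS](lin0 t).
  apply: (lin_hdeg ht) => w wq; apply: (qpairing_homog hr) => wp.
  by rewrite -wq wp eqxx in qp.
- move=> I J s r y; rewrite Rdual_map_lin rhoE; apply: eq_lin => w.
  by rewrite qpairing_map /= rho_wcls.
- by rewrite -[1]/(R_cls ROne) rho_cls /= qpairing_cls.
- move=> I J r s x; rewrite Rdual_comp_lin rhoE; apply: eq_lin => w.
  by rewrite qpairing_comp /wcomp !rho_wcls.
- move=> I r x y.
  have -> : x * y = R_cls (RMul (rep x) (rep y)) by rewrite R_clsM !R_clsK.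
  rewrite rho_cls /=.
  have -> : lin (rep x) (fun u => lin (rep y) (fun v => qpairing r (u ++ v))) =
     lin (rep x) (fun u => lin (rep y) (fun v => pair2 u v (ram_coprod r))).
    by apply: eq_lin => u; apply: eq_lin => v; rewrite pair2_coprod.
  (* The tensor is turned into a functional on functions of a pair, so that [lin_exchange] moves
     both word sums through it. *)
  pose h (F : Ram K I * Ram K I -> K^o) : K^o := tens_lift (fun r1 r2 => F (r1, r2)) (ram_coprod r).
  have hE F G : F =1 G -> h F = h G by move=> E; apply: eq_tens_lift => r1 r2; apply: E.
  have hL k F G : h (fun p => k *: F p + G p) = k *: h F + h G by apply: tens_lift_comb.
  pose G u v (p : Ram K I * Ram K I) : K^o := qpairing p.1 u * qpairing p.2 v.
  transitivity (h (fun p => lin (rep x) (fun u => lin (rep y) (fun v => G u v p)))); last first.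
    rewrite -(lin_exchange _ (fun u p => lin (rep y) (fun v => G u v p)) (h := h)) //.
    by apply: eq_lin => u; rewrite -(lin_exchange _ _ (h := h)).
  apply: eq_tens_lift => r1 r2; rewrite !rhoE.
  rewrite mulrC -[LHS]/(_ *: (lin (rep x) (qpairing r1))) -linZ; apply: eq_lin => u.
  by rewrite /GRing.scale /= mulrC -[LHS]/(_ *: (lin (rep y) (qpairing r2))) -linZ.
- move=> I r; rewrite -[1]/(R_cls ROne) rho_cls /= /ram_counit /qpairing.
  elim: (ram_rep r) => //= {r I} [I x -> y -> //|I k x -> //|I J x -> y ->].
  by rewrite /wcomp mul1r.
Qed.

Lemma rho_on_generators : on_generators rho.
Proof.
move=> I s /=.
have H g t : rho (ram_g g s) (R_cls t) = lin t (gen_word g \o wmap (bij_inv s)).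
  by rewrite rho_cls; apply: eq_lin => w; rewrite qpairing_map qpairing_cls.
by split; split; rewrite -?[1 in LHS]/(R_cls ROne) H //= /emap /= !bij_funK ?subr0.
Qed.

Lemma adm_dual I (f : Rdual K I) : adm (fun w => f (wcls w) : K^o).
Proof.
split=> [u v e1 e2|r hr u v]; first by rewrite (adm_comm adm_wcls) linearZ.
by rewrite -linear_sum (adm_rel adm_wcls hr) linear0.
Qed.

Lemma lin_rep_wcls I (f : word I -> K^o) w : adm f -> lin (rep (wcls w : Ralg K I)) f = f w.
Proof. by move=> fA; have [t [-> H]] := wcls_term (K := K) w; rewrite adm_linE. Qed.

(** On two points a word of two or more letters begins, up to sign, with a repeated a or a closed
    walk of two steps, or has a loop among its first two letters. Hence 1, a and b span R({i,j}). *)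
Lemma adm_bool_word2 (f : word bool -> K^o) e1 e2 w : adm f -> f [:: e1, e2 & w] = 0.
Proof.
move=> fA.
have H c d x y : f [:: (c, x, y), (d, y, x) & w] = 0.
  case: c d => [] []; [|exact: adm_loop_cb|exact: adm_loop_bc|exact: adm_loop_cb].
  by rewrite (adm_anti ga x y [:: _] w fA) (adm_aa fA [::]) oppr0.
have H' c d x y : f [:: (c, x, y), (d, x, y) & w] = 0.
  by rewrite (adm_anti d y x [:: _] w fA) /= H oppr0.
have D1 c x e : f [:: (c, x, x), e & w] = 0 by apply: (adm_diag _ _ [::]).
have D2 c x e : f [:: e, (c, x, x) & w] = 0 by apply: (adm_diag _ _ [:: e]).
by case: e1 e2 => [[c []] []] [[d []] []].
Qed.

Lemma eq_adm_bool (f g : word bool -> K^o) : adm f -> adm g -> f [::] = g [::] ->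
  (forall c, f [:: (c, false, true)] = g [:: (c, false, true)]) -> f =1 g.
Proof.
move=> fA gA h0 h1 [//|[[c x] y] [|e w]]; last by rewrite !adm_bool_word2.
case: x y => [] []; [by rewrite (adm_diag _ _ [::] [::] fA) (adm_diag _ _ [::] [::] gA)| |exact: h1|
  by rewrite (adm_diag _ _ [::] [::] fA) (adm_diag _ _ [::] [::] gA)].
by rewrite (adm_anti c false true [::] [::] fA) (adm_anti c false true [::] [::] gA) h1.
Qed.

(** On each monomial, the conditions on a map turn every constructor of formal composites into the
    corresponding clause of [pairing]. *)
Lemma rho_unique rho' : is_hopf_operad_map rho' -> on_generators rho' ->
  forall I (r : Ram K I) x, rho' I r x = rho r x.
Proof.
move=> [hl _ hm hi hc _ _] hg.
suff H I (M : ram_term K I) w : rho' I (ram_cls M) (wcls w) = pairing M w.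
  move=> I r x; rewrite Rdual_lin rhoE; apply: eq_lin => w.
  by rewrite -[r]ram_clsK H qpairing_cls.
have h0 J x : rho' J 0 x = 0.
  by have := hl J (-1) 0 0 x; rewrite scaler0 addr0 mulN1r addNr.
elim: M w => {I} [I|I x IHx y IHy|I k x IH|I J s x IH||I J x IHx y IHy|g] w /=.
- by rewrite -(h0 I (wcls w)).
- by rewrite -IHx -IHy -[X in X + _]mul1r -hl scale1r -(clsD (M := @ram_pres K I)).
- by rewrite -IH -[RHS]addr0 -(h0 I (wcls w)) -hl addr0 -(clsZ (M := @ram_pres K I)).
- have -> : ram_cls (MMap s x) = ram_map s (ram_cls x).
    apply/(clsP (M := @ram_pres K J)) => E hE; apply: (mc_map hE).
    exact/(lc_sym (mc_lmod hE I))/(rep_cls (M := @ram_pres K I) x E hE).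
  rewrite hm Rdual_map_lin lin_rep_wcls /= ?IH //.
  exact: (adm_wmap (can_inj (bij_invK s)) (adm_dual _)).
(* Every nonempty word on one point starts with a loop, so the value at 1 determines the image of
   the unit. *)
- case: w => [|[[c []] []] w]; first exact: hi.
  exact: (adm_diag c tt [::] w (adm_dual (rho' _ ram_id))).
- have -> : ram_cls (MComp x y) = ram_comp (ram_cls x) (ram_cls y).
    apply/(clsP (M := @ram_pres K _)) => E hE; apply: (mc_comp hE).
      exact/(lc_sym (mc_lmod hE _))/(rep_cls (M := @ram_pres K _) x E hE).
    exact/(lc_sym (mc_lmod hE _))/(rep_cls (M := @ram_pres K _) y E hE).
  rewrite hc Rdual_comp_lin lin_rep_wcls; last by apply: adm_wcomp; apply: adm_dual.
  by rewrite /wcomp IHx IHy.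
(* [on_generators] speaks of [ram_g] along a bijection; the identity of [bool] recovers [MGen]. *)
- have E h : ram_cls (MGen h) = ram_g h (bij_id fs_bool) :> Ram K _.
    apply/(clsP (M := @ram_pres K _)) => E hE.
    apply: (lc_trans (mc_lmod hE _) (lc_sym (mc_lmod hE _) (mc_map_id hE _))).
    apply: (mc_map hE).
    exact/(lc_sym (mc_lmod hE _))/(rep_cls (M := @ram_pres K _) (MGen h) E hE).
  have [[g1 g2 g3] [g4 g5 g6] [g7 g8 g9]] := hg _ (bij_id fs_bool).
  have fA := adm_dual (rho' _ (ram_cls (MGen g))).
  have F0 : rho' _ (ram_cls (MGen g)) 1 = gen_word g [::].
    by case: g {fA}; rewrite E.
  have F1 c : rho' _ (ram_cls (MGen g)) (wcls [:: (c, false, true)]) =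
      gen_word g [:: (c, false, true)].
    by rewrite /= mulr1; case: g c {fA F0} => [] []; rewrite E /= ?subr0.
  have gA : adm (gen_word g : word bool -> K^o) := adm_pairing (@MGen K g).
  exact: (eq_adm_bool fA gA F0 F1).
Qed.

Lemma rho_D I (r : Ram K I) x : rho (ram_D r) x = rho r (R_d x).
Proof.
pose delta c := if c is ga then Some gb else None.
rewrite [RHS]rho_cls (lin_der (delta := delta)); last by case.
rewrite rhoE; apply: eq_lin => w; rewrite /ram_D qpairing_cls; apply: pairing_der => [|g z].
  by move=> [] c' // [<-].
by case: g z => [] [|[[[] ?] ?] [|[[[] ?] ?] [|[[[] ?] ?] ?]]];
  rewrite /= ?(word_der0, scaler0, addr0, add0r, scale1r).
Qed.

Lemma rho_D' I (r : Ram K I) x : rho (ram_D' r) x = rho r (R_d' x).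
Proof.
pose delta c := if c is gb then Some ga else None.
rewrite [RHS]rho_cls (lin_der (delta := delta)); last by case.
rewrite rhoE; apply: eq_lin => w; rewrite /ram_D' qpairing_cls; apply: pairing_der => [|g z].
  by move=> [] c' // [<-].
by case: g z => [] [|[[[] ?] ?] [|[[[] ?] ?] [|[[[] ?] ?] ?]]];
  rewrite /= ?(word_der0, scaler0, addr0, add0r, scale1r).
Qed.

End Rho.

(** Uniqueness in the theorem is stated as equality of maps into [Rdual], not pointwise; the
    linearity proofs agree by proof irrelevance. *)
Lemma Rdual_ext (K : fieldType) (I : FiniteSet) (f g : Rdual K I) : f =1 g -> f = g.
Proof.
case: f g => f [[f1] [f2]] [g [[g1] [g2]]] /= /funext E.
by case: _ / E in g1 g2 *; rewrite (Prop_irrelevance f1 g1) (Prop_irrelevance f2 g2).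
Qed.

Theorem proposition8 (F : realType) :
  exists rho : forall I : FiniteSet, Ram F[i] I -> Rdual F[i] I,
    unique (fun rho => is_hopf_operad_map rho /\ on_generators rho) rho /\
    forall (I : FiniteSet),
      [/\ forall x : Ralg F[i] I,
            rho_star rho (R_d x) =1 transpose (@ram_D F[i] I) (rho_star rho x),
          forall x : Ralg F[i] I,
            rho_star rho (R_d' x) =1 transpose (@ram_D' F[i] I) (rho_star rho x),
          forall r : Ram F[i] I,
            rho I (ram_D r) =1 transpose (@R_d F[i] I) (rho I r) &
          forall r : Ram F[i] I,
            rho I (ram_D' r) =1 transpose (@R_d' F[i] I) (rho I r)].
Proof.
(* The even and odd parts involve a factor one half, available here in characteristic zero. *)
have char2 : (2 : F[i]) != 0 by rewrite Num.Theory.pnatr_eq0.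
exists (@rho F[i]); split.
  split=> [|rho' [h g]]; first by split; [exact: rho_hopf|exact: rho_on_generators].
  apply: functional_extensionality_dep => I; apply/funext => r; apply: Rdual_ext => x.
  by rewrite (rho_unique char2 h g).
move=> I; split=> [x r|x r|r x|r x].
- by rewrite /rho_star /transpose /= rho_D.
- by rewrite /rho_star /transpose /= rho_D'.
- exact: rho_D.
- exact: rho_D'.
Qed.
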